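(* Let $p\neq 2$ be a prime, let $Q=FG$ be a finite factorizable group with associated bismash products $H_K=K^G\# KF$ and $H_k=k^G\# kF$ over the fields $K$ and $k$ of the $p$-modular system $(K,R,k)$ described in the context. Let $\hat D=[d_{ij}]$ be the decomposition matrix of the irreducible characters $\hat\chi_i$ of $H_K$, restricted to $\mathcal B_{p'}$, with respect to the irreducible Brauer characters $\hat\phi_j$ of $H_k$, and let $\hat C=\hat D^{t}\hat D$ be the Cartan matrix. Then $\det(\hat C)$ is a power of $p$.
   Context: **Bismash products.** $Q$ is a finite group with subgroups $F,G$ such that $Q=FG$ and $F\cap G=1$. For $x\in G$, $a\in F$ write uniquely $xa=(x\rhd a)(x\lhd a)$ with $x\rhd a\in F$, $x\lhd a\in G$. Then $\lhd$ is a right action of $F$ on the set $G$; $F_x$ denotes the stabilizer in $F$ of $x\in G$. For a field $E$, $H_E=E^G\# EF$ is the Hopf algebra with $E$-basis $\mathcal B=\{p_y\# a: y\in G, a\in F\}$, multiplication $(p_x\# a)(p_y\# b)=\delta_{y,x\lhd a}\,p_x\# ab$, unit $\sum_x p_x\# 1$, comultiplication $\Delta(p_x\# a)=\sum_{y\in G}(p_{xy^{-1}}\#(y\rhd a))\otimes(p_y\# a)$, counit $\epsilon(p_x\# a)=\delta_{x,1}$, antipode $S(p_x\# a)=p_{(x\lhd a)^{-1}}\#(x\rhd a)^{-1}$ (so $S^2=\mathrm{id}$). **$p$-modular system.** $L$ is an algebraic number field that is a splitting field for $H_{\mathbb Q}=\mathbb Q^G\#\mathbb QF$; $\mathcal P$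 is a prime ideal of the ring of integers of $L$ containing the rational prime $p\ne 2$; $R$ is the completion of the ring of $\mathcal P$-integers of $L$; $K$ is its fraction field; $\pi$ generates the maximal ideal of $R$; $k=R/\pi R$. Then $K$ is a splitting field for $H_K$ and $k$ is a splitting field for $H_k$. Write $|F|=|F|_p m$ with $|F|_p$ a power of $p$ and $p\nmid m$; $R$ contains a primitive $m$-th root of unity, and reduction mod $\pi$ is a bijection from the $m$-th roots of unity in $R$ to those in $k$. **Simple modules.** Let $E=K$ or $k$. Let $x_1,\dots,x_s$ be representatives of the $F$-orbits on $G$. For $x=x_q$ and a simple $EF_x$-module $W$, put $\hat W=EF\otimes_{EF_x}W$ with $(p_y\# a)[b\otimes w]=\delta_{y\lhd(ab),x}\,ab\otimes w$. These are simple $H_E$-modules and every simple $H_E$-module arises in this way. Let $T_x$ be a set of representatives of the cosets $tF_x$ in $F$. If $W$ has character $\chi$, then $\hat W$ has character $\hat\chi(p_y\# a)=\sum_{t\in T_x,\ t^{-1}at\in F_x}\delta_{y\lhd t,x}\,\chi(t^{-1}at)$. **Brauer characters.** For a finite group $J$ with order dividing $|F|$, $J_{p'}$ is the set of elements of order prime to $p$; the Brauer character of a $kJ$-module $W$ is the function $\phi:J_{p'}\to K$ sending $g$ to the sum of the lifts to $m$-th roots of unity in $R$ of the eigenvalues of $g$ on $W$ (with multiplicity). Let $\mathcal B_{p'}=\{p_y\# a\in\mathcal B: a\in F_y\cap F_{p'}\}$. If $W$ is a simple $kF_x$-module with Brauer character $\phi$, the Brauer character of the simple $H_k$-module $\hat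 W$ is $\hat\phi:\mathcal B_{p'}\to K$, $\hat\phi(p_y\# a)=\sum_{t\in T_x,\ t^{-1}at\in F_x}\delta_{y\lhd t,x}\,\phi(t^{-1}at)$. The Brauer characters $\hat\phi_1,\dots,\hat\phi_d$ of the simple $H_k$-modules are the irreducible Brauer characters of $H_k$. **Decomposition numbers.** Let $\hat\chi_1,\dots,\hat\chi_n$ be the irreducible characters of $H_K$. The decomposition numbers are the integers $d_{ij}=d(\hat\chi_i|_{\mathcal B_{p'}},\hat\phi_j)$ with $\hat\chi_i|_{\mathcal B_{p'}}=\sum_j d_{ij}\hat\phi_j$. *)

(* Defs.v *)
From HB Require Import structures.
From mathcomp Require Import all_boot all_order all_algebra.
From mathcomp Require Import all_fingroup all_solvable all_field all_character.

Set Implicit Arguments.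
Unset Strict Implicit.
Unset Printing Implicit Defensive.

Import GroupScope GRing.Theory.
Local Open Scope ring_scope.

Section Factorization.

Variables (gT : finGroupType) (Q F G : {group gT}).
Hypothesis cFG : G \in [complements to F in Q].

(* x <| a : remgr F G picks the G-component of x a, with respect to Q = FG.   *)
Definition lact (x : [subg G]) (a : [subg F]) : [subg G] :=
  subg G (remgr F G (sgval x * sgval a)%g).

Lemma lact_mem (x : [subg G]) (a : [subg F]) :
  (sgval x * sgval a)%g \in (F * G)%g.
Proof.
have [_ defQ] := complP cFG; rewrite defQ.
have sGQ : G \subset Q by rewrite -defQ mulG_subr.
have sFQ : F \subset Q by rewrite -defQ mulG_subl.
by apply: groupM; [apply: (subsetP sGQ) | apply: (subsetP sFQ)]; apply: subgP.
Qed.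

Lemma lact1 : lact^~ 1%g =1 id.
Proof.
move=> x; have [tiFG _] := complP cFG.
by apply: val_inj; rewrite /lact /= mulg1 remgr_id ?subgP // sgvalK.
Qed.

Lemma lactM x : act_morph lact x.
Proof.
move=> a b; congr subg; rewrite /= subgK ?mem_remgr ?lact_mem // mulgA.
rewrite {1}(divgr_eq F G (sgval x * sgval a)%g) -(mulgA (divgr _ _ _)).
by rewrite remgrMl // mem_divgr // lact_mem.
Qed.

(* Accordingly F_x is 'C[x | bact], a subgroup of [subg F].                  *)
Definition bact := TotalAction lact1 lactM.

End Factorization.

Arguments bact {gT Q F G} cFG.

(* (y, a) stands for the basis element p_y # a                               *)
Notation bbasis F G := (subg_of G * subg_of F)%type.

Section Bismash.

Variables (gT : finGroupType) (Q F G : {group gT}).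
Variable cFG : G \in [complements to F in Q].
Variable E : fieldType.

Definition bismash of G \in [complements to F in Q] : Type :=
  {ffun bbasis F G -> E^o}.

Local Notation H := (bismash cFG).

HB.instance Definition _ := Vector.copy H {ffun bbasis F G -> E^o}.

Definition bvec (u : bbasis F G) : H := [ffun v => (v == u)%:R].

Definition bvec_mul (u v : bbasis F G) : H :=
  if v.1 == bact cFG u.1 u.2 then bvec (u.1, u.2 * v.2)%g else 0.

Definition bismash_mul (f g : H) : H :=
  \sum_u \sum_v (f u * g v) *: bvec_mul u v.

Definition bismash_one : H := \sum_(x : [subg G]) bvec (x, 1%g).

Lemma bismash_mulE f g x c :
  bismash_mul f g (x, c) = \sum_a f (x, a) * g (bact cFG x a, a^-1 * c)%g.
Proof.
transitivity (\sum_y \sum_a \sum_v f (y, a) * g v * bvec_mul (y, a) v (x, c)).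
  rewrite /bismash_mul sum_ffunE pair_bigA; apply: eq_bigr => -[y a] _ /=.
  by rewrite sum_ffunE; apply: eq_bigr => v _; rewrite ffunE.
rewrite (bigD1 x) //= [X in _ + X]big1 ?addr0 => [|y nyx]; last first.
  rewrite big1 // => a _; rewrite big1 // => v _; rewrite /bvec_mul.
  case: ifP => _; rewrite ffunE ?mulr0 //= xpair_eqE eq_sym (negPf nyx).
  by rewrite mulr0.
apply: eq_bigr => a _; rewrite (bigD1 (bact cFG x a, a^-1 * c)%g) //=.
rewrite [X in _ + X]big1 ?addr0 => [|[y b] nyb]; rewrite /bvec_mul /=.
  by rewrite eqxx mulKVg ffunE eqxx mulr1.
case: eqP => [y_def|_]; rewrite ffunE ?mulr0 //= xpair_eqE eqxx /=.
case: eqP => [c_def|_]; rewrite ?mulr0 //.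
by rewrite y_def c_def mulKg eqxx in nyb.
Qed.

Lemma bismash_oneE x c : bismash_one (x, c) = (c == 1%g)%:R.
Proof.
rewrite /bismash_one sum_ffunE (bigD1 x) //= ffunE xpair_eqE eqxx.
rewrite big1 ?addr0 // => y nyx.
by rewrite ffunE xpair_eqE eq_sym (negPf nyx).
Qed.

Lemma bismash_mulA : associative bismash_mul.
Proof.
move=> f g h; apply/ffunP => -[x c]; rewrite !bismash_mulE.
under [RHS]eq_bigr => b _ do rewrite bismash_mulE mulr_suml.
rewrite [RHS]exchange_big; apply: eq_bigr => a _ /=.
rewrite bismash_mulE mulr_sumr [RHS](reindex_inj (mulgI a)) /=.
apply: eq_bigr => b _.
by rewrite mulKg invMg -!mulgA mulrA -(lactM cFG).
Qed.

Lemma bismash_mul1 : left_id bismash_one bismash_mul.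
Proof.
move=> f; apply/ffunP => -[x c]; rewrite bismash_mulE (bigD1 1%g) //=.
rewrite bismash_oneE eqxx mul1r invg1 mul1g (lact1 cFG).
rewrite big1 ?addr0 // => a na; by rewrite bismash_oneE (negPf na) mul0r.
Qed.

Lemma bismash_mulr1 : right_id bismash_one bismash_mul.
Proof.
move=> f; apply/ffunP => -[x c]; rewrite bismash_mulE (bigD1 c) //=.
rewrite bismash_oneE mulVg eqxx mulr1 big1 ?addr0 // => a na.
by rewrite bismash_oneE -eq_mulVg1 (negPf na) mulr0.
Qed.

Lemma bismash_mulDl : left_distributive bismash_mul +%R.
Proof.
move=> f g h; apply/ffunP => -[x c]; rewrite ffunE !bismash_mulE -big_split.
by apply: eq_bigr => a _; rewrite ffunE mulrDl.
Qed.

Lemma bismash_mulDr : right_distributive bismash_mul +%R.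
Proof.
move=> f g h; apply/ffunP => -[x c]; rewrite ffunE !bismash_mulE -big_split.
by apply: eq_bigr => a _; rewrite ffunE mulrDr.
Qed.

Lemma bismash_1neq0 : bismash_one != 0.
Proof.
apply/eqP => /ffunP/(_ (1%g, 1%g)).
by rewrite bismash_oneE eqxx ffunE; apply/eqP/oner_neq0.
Qed.

HB.instance Definition _ := GRing.Zmodule_isNzRing.Build H
  bismash_mulA bismash_mul1 bismash_mulr1 bismash_mulDl bismash_mulDr
  bismash_1neq0.

Lemma bismash_scaleAl (e : E) (f g : H) : e *: (f * g) = (e *: f) * g.
Proof.
apply/ffunP => -[x c]; rewrite ffunE !bismash_mulE scaler_sumr.
by apply: eq_bigr => a _; rewrite ffunE scalerAl.
Qed.

HB.instance Definition _ := GRing.Lmodule_isLalgebra.Build E H bismash_scaleAl.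

Lemma bismash_scaleAr (e : E) (f g : H) : e *: (f * g) = f * (e *: g).
Proof.
apply/ffunP => -[x c]; rewrite ffunE !bismash_mulE scaler_sumr.
by apply: eq_bigr => a _; rewrite ffunE scalerAr.
Qed.

HB.instance Definition _ := GRing.Lalgebra_isAlgebra.Build E H bismash_scaleAr.

End Bismash.

Arguments bismash {gT Q F G} E cFG.
Arguments bvec {gT Q F G} cFG {E} u.

Section Modules.

Variables (gT : finGroupType) (Q F G : {group gT}).
Variable cFG : G \in [complements to F in Q].
Variable E : fieldType.

(* A nonzero finite-dimensional left module is E^n.+1 (column vectors) with a *)
(* unital algebra morphism to the matrix algebra.                             *)
Definition bismash_rep n := {lrmorphism bismash E cFG -> 'M[E]_n.+1}.

Definition simple_module n (rho : bismash_rep n) : Prop :=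
  forall U : {vspace 'cV[E]_n.+1},
    (forall h v, v \in U -> rho h *m v \in U) -> U = 0%VS \/ U = fullv.

Definition splitting_field : Prop :=
  forall n (rho : bismash_rep n), simple_module rho ->
  forall A : 'M[E]_n.+1, (forall h, rho h *m A = A *m rho h) -> is_scalar_mx A.

Definition bismash_char n (rho : bismash_rep n) : {ffun bbasis F G -> E} :=
  [ffun u => \tr (rho (bvec cFG u))].

Definition irr_character (f : {ffun bbasis F G -> E}) : Prop :=
  exists n (rho : bismash_rep n), simple_module rho /\ f = bismash_char rho.

(* T_x; lcosets are the cosets t F_x.                                        *)
Definition stab_reps (x : [subg G]) : {set [subg F]} :=
  [set repr A | A in lcosets 'C[x | bact cFG] [set: [subg F]]].

(* For the F_x-module W = E^n given by rW, [rho] is isomorphic to             *)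
(* \hat W = EF \otimes_{EF_x} W.  The linear map [tau b] is w |-> b \otimes w, *)
(* the last clause says that \hat W is the direct sum of the t \otimes W, t in T_x. *)
Definition is_hat_module m (rho : bismash_rep m) (x : [subg G]) n
    (rW : mx_representation E 'C[x | bact cFG] n) : Prop :=
  exists tau : [subg F] -> 'M[E]_(m.+1, n),
  [/\ forall b h, h \in 'C[x | bact cFG] -> tau (b * h)%g = tau b *m rW h,
      forall y a b, rho (bvec cFG (y, a)) *m tau b
                  = (bact cFG y (a * b)%g == x)%:R *: tau (a * b)%g
    & forall v : 'cV[E]_m.+1,
        exists! w : {ffun {t | t \in stab_reps x} -> 'cV[E]_n},
          v = \sum_t tau (val t) *m w t].

End Modules.

Arguments splitting_field {gT Q F G} cFG E.
Arguments irr_character {gT Q F G} cFG {E} f.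

Section NumberField.

Variable L : fieldExtType rat.
Implicit Types (P : L -> Prop) (x : L).

Definition alg_integer x : Prop := integralOver (intr : int -> L) x.

Record prime_ideal P : Prop := PrimeIdeal {
  prime_ideal_sub : forall x, P x -> alg_integer x;
  prime_ideal0 : P 0;
  prime_idealD : forall x y, P x -> P y -> P (x + y);
  prime_idealM : forall a x, alg_integer a -> P x -> P (a * x);
  prime_ideal_proper : ~ P 1;
  prime_ideal_prime : forall x y, alg_integer x -> alg_integer y ->
    P (x * y) -> P x \/ P y
}.

Definition P_integer P x : Prop :=
  exists a b, [/\ alg_integer a, alg_integer b, ~ P b & x = a / b].

Definition P_maximal P x : Prop :=
  exists a b, [/\ P a, alg_integer b, ~ P b & x = a / b].

(* The n-th power of the maximal ideal of the ring of P-integers            *)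
Fixpoint P_power P n x : Prop :=
  if n is n'.+1 then
    exists s : seq (L * L),
      (forall u, u \in s -> P_maximal P u.1 /\ P_power P n' u.2)
      /\ x = \sum_(u <- s) u.1 * u.2
  else P_integer P x.

End NumberField.

Definition rdivides (R : nzRingType) (d r : R) : Prop := exists q, r = q * d.

(* R is the completion of the ring of P-integers of L, with maximal ideal    *)
(* generated by pi.  The embedding of the P-integers in R is given through    *)
(* the induced map j of fraction fields; the P-integers are dense in R, their *)
(* own adic topology is the one induced from R, and R is Hausdorff and        *)
(* complete.                                                                  *)
Record is_completion (L : fieldExtType rat) (P : L -> Prop) (R : idomainType)
    (j : {rmorphism L -> {fraction R}}) (pi : R) : Prop := IsCompletion {
  compl_local : forall r : R, r \is a GRing.unit <-> ~ rdivides pi r;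
  compl_embed : forall x, P_integer P x -> exists r, j x = tofrac r;
  compl_induced : forall n x r, P_integer P x -> j x = tofrac r ->
    P_power P n x <-> rdivides (pi ^+ n) r;
  compl_dense : forall n r, exists x r',
    [/\ P_integer P x, j x = tofrac r' & rdivides (pi ^+ n) (r - r')];
  compl_separated : forall r, (forall n, rdivides (pi ^+ n) r) -> r = 0;
  compl_complete : forall u : nat -> R,
    (forall n, rdivides (pi ^+ n) (u n.+1 - u n)) ->
    exists l, forall n, rdivides (pi ^+ n) (l - u n)
}.

(* k = R / pi R                                                              *)
Definition is_residue_map (R : idomainType) (pi : R) (k : fieldType)
    (red : {rmorphism R -> k}) : Prop :=
  (forall z, exists r, red r = z) /\ (forall r, red r = 0 <-> rdivides pi r).

Section Brauer.

Variables (gT : finGroupType) (Q F G : {group gT}).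
Variable cFG : G \in [complements to F in Q].
Variable p : nat.
Variables (R : idomainType) (k : fieldType) (red : {rmorphism R -> k}).

Local Notation K := {fraction R}.
Local Notation m := (#|F|`_p^')%N.

(* phi is the Brauer character of W on the p'-elements of J; its values       *)
(* elsewhere are irrelevant.  The sequence s consists of the lifts of the     *)
(* eigenvalues of g on W, with multiplicity.                                  *)
Definition is_brauer_char (J : {group [subg F]}) n
    (rW : mx_representation k J n) (phi : [subg F] -> K) : Prop :=
  forall g, g \in J -> p^'.-elt g ->
  exists s : seq R,
    [/\ forall z, z \in s -> z ^+ m = 1,
        char_poly (rW g) = \prod_(z <- s) ('X - (red z)%:P)
      & phi g = \sum_(z <- s) tofrac z].

Definition preg_basis : pred (bbasis F G) :=
  fun u => (u.2 \in 'C[u.1 | bact cFG]) && p^'.-elt u.2.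

Definition breg := {u : bbasis F G | preg_basis u}.

Definition restr_breg (f : {ffun bbasis F G -> K}) : {ffun breg -> K} :=
  [ffun u => f (val u)].

Definition hat_char (x : [subg G]) (phi : [subg F] -> K)
    (u : bbasis F G) : K :=
  \sum_(t in stab_reps cFG x | (u.2 ^ t)%g \in 'C[x | bact cFG])
    (bact cFG u.1 t == x)%:R * phi (u.2 ^ t)%g.

Definition irr_brauer_character (f : {ffun breg -> K}) : Prop :=
  exists l (rho : bismash_rep cFG k l), simple_module rho /\
  exists (x : [subg G]) n (rW : mx_representation k 'C[x | bact cFG] n) phi,
    [/\ mx_irreducible rW, is_hat_module rho rW, is_brauer_char rW phi
      & f = [ffun u => hat_char x phi (val u)]].

End Brauer.

Arguments breg {gT Q F G} cFG p.
Arguments restr_breg {gT Q F G} cFG p {R} f.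
Arguments irr_brauer_character {gT Q F G} cFG {p R k} red f.

(* Main.v *)
From HB Require Import structures.
Require Import Defs.
From mathcomp Require Import all_boot all_order all_algebra.
From mathcomp Require Import all_fingroup all_solvable all_field all_character.
From Stdlib Require Import Classical.
From Stdlib Require List.

(** A basis element [p_y # a] is a loop when [a] fixes [y].  Let [Phi] be the matrix
    of the values of the irreducible Brauer characters on the p-regular loops [u],
    let [Phi'] be the transposed matrix of their values on the dual elements [u'],
    where [u' = p_y # a^-1] for [u = p_y # a], and let [C = D^T D].

    The algebra over [K] is split semisimple and symmetric, so its irreducible
    characters satisfy column orthogonality: the sum of [chi u' * chi v] over all
    [chi] is the number [M u v] of elements of [F] that conjugate the loop [u] to
    the loop [v].  On p-regular loops the values of the [chi] form the matrix
    [D Phi], hence [Phi' C Phi = M].  Brauer characters are constant on conjugate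
    loops, so [Phi M = #|F| Phi].  The rows of [Phi] are linearly independent, and
    cancelling [Phi] leaves

      [(Phi Phi') C = #|F|].

    For a prime [q] other than [p], every entry of [Phi Phi'] is an algebraic
    integer times the [q]-part of [#|F|].  After division by that [q]-part, [C] has
    a left inverse up to a factor prime to [q] among matrices of algebraic integers,
    so [q] does not divide the determinant of [C].  As a Gram determinant is not
    negative, it is a power of [p] ([det_prime_power], [det_gram_ge0]).

    Three facts carry this argument.
    - Column orthogonality ([hirr_char_column_orth_map]).  Sums over dual bases give
      the Schur relations, and a function on loops that is orthogonal to all
      irreducible characters is a central element that acts as zero on every simple
      module, hence is zero.  This is done over the splitting field [L]; the
      irreducible characters over [K] are the same ones.
    - Linear independence ([brval_free]).  Orbit by orbit it is the independence of
      the Brauer characters of the irreducible modules of a stabiliser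
      ([brchar_free]): a relation, normalised so as to survive the reduction, would
      be a relation between the traces of non-isomorphic irreducible modules.
    - Divisibility ([int_dvd_brval_product]).  Summing over orbits reduces it to
      products of two Brauer characters of one group [J], that is to the Brauer
      character of a tensor product.  A theorem of Frobenius type
      ([int_dvd_qelt_sum], [int_dvd_p'elt_sum]) reduces the sum over the p-regular
      elements of [J] to sums over cosets [c T], with [T] a [q]-subgroup that
      centralises [c]; there, an irreducible constituent contributes either
      [#|T|] equal terms or 0 ([irr_qgroup_brtr_sum]). *)

Set Implicit Arguments.
Unset Strict Implicit.
Unset Printing Implicit Defensive.

Import GroupScope GRing.Theory.
Local Open Scope ring_scope.

(** * Brauer traces of matrices of finite order *)

Section BrauerTrace.

Variables (R : idomainType) (E : fieldType) (red : {rmorphism R -> E}).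
Variables (m : nat) (z : R).
Hypotheses (mE : m%:R != 0 :> E) (prim_z : m.-primitive_root z).

Let m_gt0 : (0 < m)%N := prim_order_gt0 prim_z.

(** If [w = z ^+ d] reduces to 1, then the sum of the [m %/ d] powers of [w]
    reduces to [m %/ d], which is not 0; since [w - 1] times this sum is 0, [w = 1]. *)
Lemma red_prim_root : m.-primitive_root (red z).
Proof.
have zm : red z ^+ m = 1 by rewrite -rmorphXn (prim_expr_order prim_z) rmorph1.
have [d prim_d d_dv_m] := prim_order_exists m_gt0 zm.
suff -> : m = d by [].
apply/eqP; rewrite eqn_dvd d_dv_m andbT (prim_order_dvd prim_z).
apply/eqP; set w := z ^+ d.
have [m' def_m] := dvdnP d_dv_m.
have wm : w ^+ m' = 1 by rewrite -exprM mulnC -def_m (prim_expr_order prim_z).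
have rw : red w = 1 by rewrite rmorphXn (prim_expr_order prim_d).
have /eqP : (w - 1) * (\sum_(i < m') w ^+ i) = 0 by rewrite -subrX1 wm subrr.
rewrite mulf_eq0 subr_eq0 => /orP[/eqP //|/eqP/(congr1 red)].
rewrite rmorph0 rmorph_sum (eq_bigr (fun=> 1)) => [|i _]; last first.
  by rewrite rmorphXn rw expr1n.
rewrite sumr_const card_ord => m'0; case/negP: mE.
by rewrite def_m natrM m'0 mul0r.
Qed.

(** The lift of an [m]-th root of unity.  As a sum over the candidates it needs no
    choice, and it visibly commutes with extensions of [E]. *)
Definition teich (x : E) : R := \sum_(i < m) z ^+ i *+ (red (z ^+ i) == x).

Lemma red_unity_inj i j : red (z ^+ i) = red (z ^+ j) -> z ^+ i = z ^+ j.
Proof.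
rewrite !rmorphXn => /eqP; rewrite (eq_prim_root_expr red_prim_root) => /eqP e.
by apply/eqP; rewrite (eq_prim_root_expr prim_z) e.
Qed.

(** An integral domain contains at most [m] roots of unity of order dividing [m],
    by comparison with its field of fractions. *)
Lemma unity_expr w : w ^+ m = 1 -> exists i : 'I_m, w = z ^+ i.
Proof.
pose f := @tofrac R : {rmorphism R -> {fraction R}} => wm.
have prim_fz : m.-primitive_root (f z).
  rewrite /primitive_root_of_unity m_gt0; apply/forallP => i.
  rewrite unity_rootE -rmorphXn -(rmorph1 f) tofrac_eq.
  have /andP[_ /forallP/(_ i)] := prim_z; by rewrite unity_rootE.
have fwm : f w ^+ m = 1 by rewrite -rmorphXn wm rmorph1.
have [i /eqP] := prim_rootP prim_fz fwm.
by rewrite -rmorphXn tofrac_eq => /eqP; exists i.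
Qed.

Lemma teichK w : w ^+ m = 1 -> teich (red w) = w.
Proof.
move=> wm; have [i ->] := unity_expr wm.
rewrite /teich (bigD1 i) //= eqxx mulr1n big1 ?addr0 // => j nji.
have [e|//] := red (z ^+ j) =P red (z ^+ i); case/negP: nji.
have /eqP := red_unity_inj e.
by rewrite (eq_prim_root_expr prim_z) !modn_small.
Qed.

Lemma unityP x : x ^+ m = 1 -> exists2 w, w ^+ m = 1 & x = red w.
Proof.
move=> xm; have [i ->] := prim_rootP red_prim_root xm; exists (z ^+ i); last by rewrite rmorphXn.
by rewrite -exprM mulnC exprM (prim_expr_order prim_z) expr1n.
Qed.

Lemma red_teich x : x ^+ m = 1 -> red (teich x) = x.
Proof. by case/unityP => w w1 ->; rewrite teichK. Qed.

Lemma teichM x y : x ^+ m = 1 -> y ^+ m = 1 -> teich (x * y) = teich x * teich y.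
Proof.
case/unityP=> v v1 -> /unityP[w w1 ->].
by rewrite -rmorphM !teichK // exprMn v1 w1 mulr1.
Qed.

(** The sum of the lifts of the eigenvalues of [A], each read off from its
    multiplicity as a root of the characteristic polynomial; this makes sense for
    every matrix, and is the value of a Brauer character when [A ^+ m = 1]. *)
Definition brtr n (A : 'M[E]_n) : R :=
  \sum_(i < m) z ^+ i *+ mup (red (z ^+ i)) (char_poly A).

Lemma brtr_prod n (A : 'M_n) s :
  char_poly A = \prod_(x <- s) ('X - x%:P) -> brtr A = \sum_(x <- s) teich x.
Proof.
rewrite /brtr => ->; rewrite exchange_big; apply: eq_bigr => i _ /=.
rewrite mu_prod_XsubC -sum1_count -sumrMnr big_mkcond /=.
by apply: eq_bigr => x _; rewrite eq_sym; case: eqP.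
Qed.

Lemma brtr_lifts n (A : 'M_n) s : (forall w, w \in s -> w ^+ m = 1) ->
  char_poly A = \prod_(w <- s) ('X - (red w)%:P) -> brtr A = \sum_(w <- s) w.
Proof.
move=> s1; rewrite -(big_map red xpredT (fun x => 'X - x%:P)) => def_p.
rewrite (brtr_prod def_p) big_map big_seq [RHS]big_seq.
by apply: eq_bigr => w /s1/teichK.
Qed.

Lemma char_poly_conj n (P A : 'M[E]_n) :
  P \in unitmx -> char_poly (invmx P *m A *m P) = char_poly A.
Proof.
move=> uP; rewrite /char_poly /char_poly_mx !map_mxM.
have {1}-> : 'X%:M = map_mx polyC (invmx P) *m 'X%:M *m map_mx polyC P :> 'M_n.
  by rewrite scalar_mxC -mulmxA -map_mxM mulVmx // map_mx1 mulmx1.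
rewrite -mulmxBl -mulmxBr !det_mulmx mulrAC -det_mulmx -map_mxM mulVmx //.
by rewrite map_mx1 det1 mul1r.
Qed.

(** ['X^m - 1] is a product of distinct linear factors over [E]. *)
Lemma finite_order_diag n (A : 'M[E]_n) : A ^+ m = 1 ->
  exists P (d : 'rV_n), [/\ P \in unitmx, A = invmx P *m diag_mx d *m P
    & forall i, d 0 i ^+ m = 1].
Proof.
case: n A => [|n] A Am1.
  by exists 1%:M, 0; rewrite unitmx1; split=> // [|[]//]; apply/matrixP => -[].
have : diagonalizable A.
  apply/diagonalizableP; exists [seq red z ^+ i | i <- index_iota 0 m].
    rewrite map_inj_in_uniq ?iota_uniq // => i j.
    rewrite !mem_index_iota => /= ltim ltjm /eqP.
    by rewrite (eq_prim_root_expr red_prim_root) !modn_small // => /eqP.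
  rewrite big_map (factor_Xn_sub_1 red_prim_root) dvd_mxminpoly.
  by rewrite rmorphB rmorphXn /= horner_mx_X rmorph1 Am1 subrr.
case=> P uP /diagonalizable_forPex[d /(simmxRL uP) defA].
exists P, d; split=> //.
  by rewrite defA !mulmxA mulVmx // mul1mx mulmxKV.
have : diag_mx d ^+ m = 1.
  have Xm k : diag_mx d ^+ k = P *m (A ^+ k) *m invmx P.
    elim: k => [|k IHk]; first by rewrite !expr0 mulmx1 mulmxV.
    rewrite !exprS IHk defA -!mulmxE !mulmxA.
    by rewrite mulmxKV.
  by rewrite Xm Am1 mulmx1 mulmxV.
have -> k : diag_mx d ^+ k = diag_mx (\row_i d 0 i ^+ k).
  elim: k => [|k IHk].
    rewrite expr0 -[1]/(1%:M) -diag_const_mx; congr diag_mx; apply/rowP => i.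
    by rewrite !mxE expr0.
  rewrite exprS IHk -mulmxE mulmx_diag; congr diag_mx; apply/rowP => i.
  by rewrite !mxE exprS.
by move=> dm i; move/matrixP/(_ i i): dm; rewrite !mxE eqxx !mulr1n.
Qed.

Lemma char_poly_diag n (d : 'rV[E]_n) :
  char_poly (diag_mx d) = \prod_(x <- [seq d 0 i | i <- enum 'I_n]) ('X - x%:P).
Proof.
rewrite char_poly_trig ?diag_mx_is_trig // big_map big_enum.
by apply: eq_bigr => i _; rewrite mxE eqxx mulr1n.
Qed.

Lemma brtr_diag n (P : 'M_n) (d : 'rV_n) : P \in unitmx ->
  brtr (invmx P *m diag_mx d *m P) = \sum_i teich (d 0 i).
Proof.
move=> uP; rewrite (@brtr_prod _ _ [seq d 0 i | i <- enum 'I_n]).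
  by rewrite big_map big_enum.
by rewrite char_poly_conj // char_poly_diag.
Qed.

Lemma red_brtr n (A : 'M_n) : A ^+ m = 1 -> red (brtr A) = \tr A.
Proof.
case/finite_order_diag => P [d [uP -> d1]].
rewrite brtr_diag // mxtrace_mulC mulmxA mulmxV // mul1mx mxtrace_diag rmorph_sum.
by apply: eq_bigr => i _; rewrite red_teich.
Qed.

Lemma brtr_scale n a (A : 'M_n) : a ^+ m = 1 -> A ^+ m = 1 ->
  brtr (a *: A) = teich a * brtr A.
Proof.
move=> a1 /finite_order_diag[P [d [uP -> d1]]].
rewrite scalemxAl scalemxAr -linearZ /= !brtr_diag // mulr_sumr.
by apply: eq_bigr => i _; rewrite mxE teichM.
Qed.

(** The Kronecker product, as the matrix of [X |-> A^T X B] on vectorised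
    matrices [X]; it makes tensor products of representations available. *)
Definition kron n1 n2 (A : 'M[E]_n1) (B : 'M[E]_n2) : 'M[E]_(n1 * n2) :=
  lin_mx (fun X => A^T *m X *m B).

Lemma mul_rV_kron n1 n2 (A : 'M_n1) (B : 'M_n2) u :
  u *m kron A B = mxvec (A^T *m vec_mx u *m B).
Proof. exact: (mul_rV_lin (mulmxr B \o mulmx A^T)). Qed.

Lemma kronM n1 n2 (A1 A2 : 'M_n1) (B1 B2 : 'M_n2) :
  kron (A1 *m A2) (B1 *m B2) = kron A1 B1 *m kron A2 B2.
Proof.
apply/row_matrixP => i; rewrite !rowE mulmxA !mul_rV_kron mxvecK trmx_mul.
by rewrite !mulmxA.
Qed.

Lemma kron1 n1 n2 : kron (1%:M : 'M_n1) (1%:M : 'M_n2) = 1%:M.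
Proof.
apply/row_matrixP => i; rewrite !rowE mul_rV_kron trmx1 mul1mx mulmx1 vec_mxK.
by rewrite mulmx1.
Qed.

Lemma kron_diag n1 n2 (d1 : 'rV_n1) (d2 : 'rV_n2) :
  kron (diag_mx d1) (diag_mx d2) = diag_mx (mxvec (d1^T *m d2)).
Proof.
apply/row_matrixP => i; rewrite !rowE mul_rV_kron tr_diag_mx.
apply/rowP => j; case/mxvec_indexP: j => j1 j2; rewrite mxvecE.
rewrite !mul_mx_diag mul_diag_mx [LHS]mxE [RHS]mxE mxvecE.
rewrite [X in X * _ = _]mxE [in X in _ = _ * X]mxE big_ord1 [d1^T _ _]mxE.
rewrite -[X in _ * X * _](mxvecE (vec_mx _)) vec_mxK.
by rewrite mulrAC mulrC.
Qed.

Lemma invmx_kron n1 n2 (A : 'M_n1) (B : 'M_n2) :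
  A \in unitmx -> B \in unitmx ->
  kron A B \in unitmx /\ invmx (kron A B) = kron (invmx A) (invmx B).
Proof.
move=> uA uB.
have e : kron A B *m kron (invmx A) (invmx B) = 1%:M.
  by rewrite -kronM !mulmxV // kron1.
have [uAB _] := mulmx1_unit e; split=> //.
by apply: (can_inj (mulKmx uAB)); rewrite mulmxV.
Qed.

Lemma brtr_kron n1 n2 (A : 'M_n1) (B : 'M_n2) : A ^+ m = 1 -> B ^+ m = 1 ->
  brtr (kron A B) = brtr A * brtr B.
Proof.
case/finite_order_diag => P [d [uP -> d1]] /finite_order_diag[S [e [uS -> e1]]].
rewrite !kronM; have [uPS <-] := invmx_kron uP uS.
rewrite kron_diag !brtr_diag // (reindex _ (curry_mxvec_bij _ _)) /=.
rewrite mulr_suml; under [RHS]eq_bigr do rewrite mulr_sumr.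
rewrite [RHS]pair_bigA /=; apply: eq_bigr => -[i j] _ /=.
by rewrite mxvecE mxE big_ord1 mxE teichM.
Qed.

End BrauerTrace.

(** * Group algebras separate irreducible representations *)

Section CharPolyBlock.

Variable E : fieldType.

Lemma char_poly_transport n n' (P : 'M[E]_(n', n)) (Q : 'M_(n, n')) (A : 'M_n) :
  n' = n -> P *m Q = 1%:M -> char_poly (P *m A *m Q) = char_poly A.
Proof.
move=> def_n; rewrite {n'}def_n in P Q * => PQ1.
have [uP uQ] := mulmx1_unit PQ1.
have -> : P = invmx Q by apply: (can_inj (mulmxK uQ)); rewrite mulVmx.
exact: char_poly_conj.
Qed.

Lemma char_poly_lblock n1 n2 (A : 'M[E]_n1) (C : 'M_(n2, n1)) (D : 'M_n2) :
  char_poly (block_mx A 0 C D) = char_poly A * char_poly D.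
Proof.
rewrite /char_poly /char_poly_mx map_block_mx map_mx0 scalar_mx_block.
by rewrite opp_block_mx add_block_mx oppr0 addr0 det_lblock.
Qed.

End CharPolyBlock.

Section Separation.

Variables (E : fieldType) (gT : finGroupType) (G : {group gT}).
Implicit Type n : nat.
Local Notation reprG := (mx_representation E G).
Local Notation aG := (regular_repr E G).

Lemma char_poly_sub_fact n (rG : reprG n) (U : 'M_n) (modU : mxmodule rG U) x :
  x \in G ->
  char_poly (rG x) = char_poly (submod_mx modU x) * char_poly (factmod_mx modU x).
Proof.
move=> Gx; set A := rG x.
pose S := val_submod (1%:M : 'M_(\rank U)); pose S' := in_submod U 1%:M.
pose F := val_factmod (1%:M : 'M_(\rank (cokermx U))); pose F' := in_factmod U 1%:M.
have SS : S *m S' = 1%:M by rewrite -in_submodE val_submodK.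
have FF : F *m F' = 1%:M by rewrite -in_factmodE val_factmodK.
have SF B : (B <= U)%MS -> B *m F' = 0.
  by move=> sBU; rewrite -in_factmodE; apply/eqP; rewrite in_factmod_eq0.
have sSU : (S <= U)%MS by apply: val_submodP.
have FS : F *m S' = 0.
  by rewrite -in_submodE; apply/eqP; rewrite in_submod_eq0 val_factmodP.
have def_n : (\rank U + \rank (cokermx U))%N = n.
  by rewrite mxrank_coker subnKC ?rank_leq_row.
rewrite -(@char_poly_transport _ _ _ (col_mx S F) (row_mx S' F') A def_n).
  rewrite mul_col_mx mul_col_row (SF _ (S *m A)); last first.
    by apply: mxmodule_trans sSU.
  have -> : submod_mx modU x = S *m A *m S' by rewrite /submod_mx in_submodE.
  have -> : factmod_mx modU x = F *m A *m F' by rewrite /factmod_mx in_factmodE.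
  by rewrite char_poly_lblock.
by rewrite mul_col_row SS FF (SF _ _ sSU) FS -scalar_mx_block.
Qed.

Lemma gring_mxE n (rG : reprG n) a :
  gring_mx rG a = \sum_i a 0 i *: rG (enum_val i).
Proof.
rewrite /gring_mx /= mulmx_sum_row linear_sum; apply: eq_bigr => i _.
by rewrite linearZ /= rowK mxvecK.
Qed.

Lemma gring_mx1 n (rG : reprG n) : gring_mx rG (gring_row 1%:M) = 1%:M.
Proof. by rewrite -gring_opE gring_op1. Qed.

Lemma gring_mx_hom n1 n2 (r1 : reprG n1) (r2 : reprG n2) (f : 'M_(n1, n2)) a :
  (forall x, x \in G -> r1 x *m f = f *m r2 x) ->
  gring_mx r1 a *m f = f *m gring_mx r2 a.
Proof.
move=> homf; rewrite !gring_mxE mulmx_suml mulmx_sumr; apply: eq_bigr => i _.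
by rewrite -scalemxAl homf ?enum_valP // -scalemxAr.
Qed.

(** Irreducibility makes [w] and [y] cyclic vectors, and the hypothesis makes the
    map [w b |-> y b] well defined; it is a nonzero homomorphism between irreducible
    modules. *)
Lemma irr_cyclic_rsim n1 n2 (r1 : reprG n1) (r2 : reprG n2)
    (w : 'rV_n1) (y : 'rV_n2) :
    mx_irreducible r1 -> mx_irreducible r2 -> w != 0 -> y != 0 ->
    (forall b, w *m gring_mx r1 b = 0 -> y *m gring_mx r2 b = 0) ->
  mx_rsim r1 r2.
Proof.
move=> /mx_irrP[n1_gt0 irr1] /mx_irrP[n2_gt0 irr2] nzw nzy w0y0.
pose U := lin1_mx (mulmx w \o gring_mx r1).
pose V := lin1_mx (mulmx y \o gring_mx r2).
have UE b : b *m U = w *m gring_mx r1 b by rewrite mul_rV_lin1.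
have VE b : b *m V = y *m gring_mx r2 b by rewrite mul_rV_lin1.
have UJ (b : 'rV_#|G|) x : x \in G -> b *m U *m r1 x = b *m aG x *m U.
  by move=> Gx; rewrite !UE gring_mxJ // mulmxA.
have VJ (b : 'rV_#|G|) x : x \in G -> b *m V *m r2 x = b *m aG x *m V.
  by move=> Gx; rewrite !VE gring_mxJ // mulmxA.
have fullU : row_full U.
  rewrite /row_full -genmxE; apply: irr1.
    rewrite (eqmx_module _ (genmxE _)); apply/mxmoduleP => x Gx.
    by apply/row_subP => i; rewrite !rowE mulmxA UJ // submxMl.
  rewrite (eqmx_eq0 (genmxE _)); apply: contraNneq nzw => U0.
  have := UE (gring_row 1%:M); rewrite gring_mx1 mulmx1 U0 mulmx0.
  by move <-.
pose f := pinvmx U *m V.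
have Uf (b : 'rV_#|G|) : b *m U *m f = b *m V.
  pose c := b - b *m U *m pinvmx U.
  have cU : c *m U = 0 by rewrite mulmxBl mulmxKpV ?submxMl // subrr.
  have : c *m V = 0 by rewrite VE w0y0 // -UE.
  rewrite mulmxBl => /eqP; rewrite subr_eq0 => /eqP ->.
  by rewrite mulmxA.
clearbody f.
have homf x : x \in G -> r1 x *m f = f *m r2 x.
  move=> Gx; apply: (row_full_inj fullU); apply/row_matrixP => i.
  by rewrite !rowE !mulmxA UJ // Uf -VJ // -Uf.
have nzf : f != 0.
  apply: contraNneq nzy => f0; rewrite -[y]mulmx1 -(gring_mx1 r2) -VE -Uf.
  by rewrite f0 mulmx0.
have freef : row_free f.
  rewrite -kermx_eq0; apply: contraNT nzf => nzK.
  have /irr1/(_ nzK) fullK : mxmodule r1 (kermx f).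
    apply/mxmoduleP => x Gx; apply/sub_kermxP.
    by rewrite -mulmxA homf // mulmxA mulmx_ker mul0mx.
  by rewrite -(mul1mx f); apply/eqP/sub_kermxP; rewrite sub1mx.
have fullf : row_full f.
  rewrite /row_full -genmxE; apply: irr2; last by rewrite (eqmx_eq0 (genmxE _)).
  rewrite (eqmx_module _ (genmxE _)); apply/mxmoduleP => x Gx.
  by rewrite -homf // submxMl.
by exists f => //; rewrite -(eqP freef) (eqP fullf).
Qed.

(** Filter the group algebra by the right ideals of elements whose first [t]
    rows vanish in [r1]: some layer of this filtration is not killed by a given
    nonzero vector of [r2], and that layer is a quotient of a copy of [r1]. *)
Lemma irr_annihilator_rsim n1 n2 (r1 : reprG n1) (r2 : reprG n2) :
    mx_irreducible r1 -> mx_irreducible r2 ->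
    (forall b, gring_mx r1 b = 0 -> gring_mx r2 b = 0) ->
  mx_rsim r1 r2.
Proof.
move=> irr1 irr2 ann12; have [_ nz1 _] := irr2.
pose y := nz_row (1%:M : 'M[E]_n2); have nzy : y != 0 by rewrite nz_row_eq0.
pose rows0 t a := forall i : 'I_n1, (i < t)%N -> row i (gring_mx r1 a) = 0.
pose kills t := forall a, rows0 t a -> y *m gring_mx r2 a = 0.
have kills_n : kills n1.
  move=> a a0; rewrite ann12 ?mulmx0 //; apply/row_matrixP => i.
  by rewrite a0 ?row0.
have [t [ltn Nt St]] : exists t, [/\ (t < n1)%N, ~ kills t & kills t.+1].
  have Nkills0 : ~ kills 0%N.
    move=> /(_ (gring_row 1%:M)); rewrite gring_mx1 mulmx1 => y0.
    by case/eqP: nzy; apply: y0.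
  apply: NNPP => noT; suff allk j : (j <= n1)%N -> kills (n1 - j)%N.
    by apply: Nkills0; rewrite -(subnn n1); apply: allk.
  elim: j => [|j IHj] ltj; first by rewrite subn0.
  apply: NNPP => Nk; apply: noT; exists (n1 - j.+1)%N; split=> //.
    by rewrite ltn_subrL (leq_trans _ ltj).
  by rewrite -subSn // subSS; apply: IHj; apply: ltnW.
have [a [a0 nzya]] : exists a, rows0 t a /\ y *m gring_mx r2 a <> 0.
  apply: NNPP => no_a; apply: Nt => a a0; apply: NNPP => nzya.
  by apply: no_a; exists a.
pose w := row (Ordinal ltn) (gring_mx r1 a).
have wa b : w *m gring_mx r1 b = 0 -> y *m gring_mx r2 a *m gring_mx r2 b = 0.
  move=> wb0; rewrite -mulmxA -gring_mxA; apply: St => i.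
  rewrite ltnS leq_eqVlt gring_mxA row_mul => /orP[/eqP i_t|/a0 ->].
    by have -> : i = Ordinal ltn by apply: val_inj.
  by rewrite mul0mx.
apply: irr_cyclic_rsim wa => //; last exact/eqP.
apply/eqP => w0; apply: nzya; apply: St => i; rewrite ltnS leq_eqVlt.
by case/orP=> [/eqP i_t|/a0 //]; rewrite -w0; congr row; apply: val_inj.
Qed.

(** If the sum of the two annihilators were proper, an irreducible submodule of
    the quotient of the group algebra by it would be similar to both. *)
Lemma irr_separate n1 n2 (r1 : reprG n1) (r2 : reprG n2) :
    mx_irreducible r1 -> mx_irreducible r2 -> ~ mx_rsim r1 r2 ->
  exists e, gring_mx r1 e = 1%:M /\ gring_mx r2 e = 0.
Proof.
move=> irr1 irr2 Nsim.
pose ann n (r : reprG n) := kermx (lin1_mx (mxvec \o gring_mx r)).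
have annP n (r : reprG n) a : reflect (gring_mx r a = 0) (a <= ann n r)%MS.
  apply: (iffP sub_kermxP); rewrite mul_rV_lin1 /=; last by move->; rewrite linear0.
  by move/(canRL mxvecK); rewrite linear0.
have annmod n (r : reprG n) : mxmodule aG (ann n r).
  apply/mxmoduleP => x Gx; apply/row_subP => i; rewrite row_mul.
  by apply/annP; rewrite gring_mxJ // (annP _ _ _ (row_sub _ _)) mul0mx.
have annM n (r : reprG n) (a b : 'rV_#|G|) : gring_mx r b = 0 -> (a *m gring_mx aG b <= ann n r)%MS.
  by move=> b0; apply/annP; rewrite gring_mxA b0 mulmx0.
pose I := (ann _ r1 + ann _ r2)%MS.
have modI : mxmodule aG I by rewrite addsmx_module ?annmod.
have [|NI1] := boolP (gring_row (1%:M : 'M[E]_#|G|) <= I)%MS.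
  case/sub_addsmxP => -[u v] /= def1.
  exists (v *m ann _ r2); split; last by apply/annP; rewrite submxMl.
  have u0 : gring_mx r1 (u *m ann _ r1) = 0 by apply/annP; rewrite submxMl.
  by have := congr1 (gring_mx r1) def1; rewrite gring_mx1 linearD /= u0 add0r.
have nzQ : (1%:M : 'M[E]_(\rank (cokermx I))) != 0.
  apply: contra NI1; rewrite -mxrank_eq0 mxrank1 => /eqP rk0.
  have := mxrank_coker I; rewrite rk0 => /esym/eqP; rewrite subn_eq0 => leI.
  by apply: submx_full; rewrite /row_full eqn_leq rank_leq_col.
case: Nsim; apply: NNPP => Nsim.
have /classicP : classically (exists2 V, mxsimple (factmod_repr modI) V & (V <= 1%:M)%MS).
  by apply: mxsimple_exists; rewrite ?mxmodule1.
apply=> -[V simV _].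
have modV := mxsimple_module simV.
pose Y := submod_repr modV.
have irrY : mx_irreducible Y by apply/submod_mx_irr.
have Y0 b : (forall a : 'rV_#|G|, (a *m gring_mx aG b <= I)%MS) -> gring_mx Y b = 0.
  move=> abI; apply: (@val_submod_inj _ _ V); rewrite linear0.
  rewrite val_submodE (@gring_mx_hom _ _ Y (factmod_repr modI)); last first.
    by move=> x Gx; rewrite -val_submodE -val_submodJ // mul1mx.
  suff -> : gring_mx (factmod_repr modI) b = 0 by rewrite mulmx0.
  have z0 : in_factmod I (val_factmod (1%:M : 'M_(\rank (cokermx I))) *m gring_mx aG b) = 0.
    apply/eqP; rewrite in_factmod_eq0; apply/row_subP => j; rewrite row_mul.
    exact: abI.
  rewrite -(mul1mx (gring_mx _ b)) -[1%:M](val_factmodK (1%:M : 'M_(\rank (cokermx I)))).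
  rewrite in_factmodE -mulmxA -(@gring_mx_hom _ _ aG); last first.
    by move=> x Gx; rewrite -in_factmodE -in_factmodJ // mul1mx.
  by rewrite mulmxA -in_factmodE z0.
have sim1 : mx_rsim r1 Y.
  apply: irr_annihilator_rsim => // b b0; apply: Y0 => a.
  by apply: submx_trans (annM _ r1 a b b0) (addsmxSl _ _).
have sim2 : mx_rsim r2 Y.
  apply: irr_annihilator_rsim => // b b0; apply: Y0 => a.
  by apply: submx_trans (annM _ r2 a b b0) (addsmxSr _ _).
by apply: Nsim; apply: mx_rsim_trans sim1 (mx_rsim_sym sim2).
Qed.

End Separation.

(** * Linear independence of irreducible Brauer characters *)

Section NilpotentTrace.

Variable E : fieldType.

(** In a rank factorisation [A = C *m B] the traces of [C *m B] and [B *m C] agree,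
    and [B *m C] is a nilpotent matrix of smaller size. *)
Lemma mxtrace_nilpotent n (A : 'M[E]_n) N : A ^+ N = 0 -> \tr A = 0.
Proof.
have [r] := ubnP n; elim: r => // r IHr in n A N *; rewrite ltnS => le_n_r AN.
case: (posnP n) => [n0|n_gt0].
  by rewrite /mxtrace big1 // => i; have := ltn_ord i; rewrite {2}n0.
have expP (C : 'M_(n, \rank A)) (B : 'M_(\rank A, n)) k :
    (B *m C) ^+ k.+1 = B *m (C *m B) ^+ k *m C.
  elim: k => [|k IHk]; first by rewrite expr1 expr0 -[1]/(1%:M) mulmx1.
  by rewrite exprS IHk [in RHS]exprS -!mulmxE !mulmxA.
rewrite -{1}(mulmx_base A) mxtrace_mulC.
apply: (IHr _ _ N.+1); last by rewrite expP mulmx_base AN mulmx0 mul0mx.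
apply: leq_trans le_n_r; rewrite ltn_neqAle rank_leq_row andbT.
apply: contraTneq n_gt0 => rA; have uA : A \in unitmx.
  by rewrite -row_free_unit /row_free rA.
have : A ^+ N \in unitmx.
  elim: N {AN} => [|k IHk]; first by rewrite expr0 unitmx1.
  by rewrite exprS unitmx_mul uA.
by rewrite AN -row_free_unit /row_free mxrank0 eq_sym -leqn0 leqNgt lt0n.
Qed.

(** In characteristic [p] the difference of the commuting matrices of [x] and of
    its [p']-part is nilpotent: raise it to the power [#[x.`_p]]. *)
Lemma mxtrace_p'part (gT : finGroupType) (G : {group gT}) n
    (rG : mx_representation E G n) p x :
  p \in [pchar E] -> x \in G -> \tr (rG x) = \tr (rG x.`_p^').
Proof.
move=> pE Gx; set y := x.`_p^'.
have Gy : y \in G by rewrite groupX.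
case: n rG => [|n] rG; first by rewrite /mxtrace !big_ord0.
have pM : p \in [pchar 'M[E]_n.+1] by rewrite pchar_lalg.
have cxy : GRing.comm (rG x) (rG y).
  by rewrite /GRing.comm -!repr_mxMr // (commuteX _ (commute_refl x)).
have frob a : (rG x - rG y) ^+ (p ^ a) = rG x ^+ (p ^ a) - rG y ^+ (p ^ a).
  elim: a => [|a IHa]; first by rewrite !expr1.
  rewrite expnSr !exprM IHa -!(pFrobenius_autE pM) pFrobenius_autB_comm //.
  by apply: commrX; apply: commr_sym; apply: commrX; apply: commr_sym.
apply/eqP; rewrite -subr_eq0 -raddfB /=; apply/eqP.
apply: (@mxtrace_nilpotent _ _ (p ^ logn p #[x])).
have def_q : #[x.`_p] = (p ^ logn p #[x])%N by rewrite order_constt p_part.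
rewrite frob -!repr_mxX // -def_q; apply/eqP; rewrite subr_eq0; apply/eqP.
congr (rG _); set q := #[_]; rewrite -(consttC p x) expgMn ?expg_order ?mul1g //.
by apply/commute_sym/commuteX/commute_sym/commuteX.
Qed.

End NilpotentTrace.

Section ChangeField.

Variables (R : idomainType) (E E' : fieldType) (red : {rmorphism R -> E}).
Variable (f : {rmorphism E -> E'}).
Variables (m : nat) (z : R).
Hypotheses (mE : m%:R != 0 :> E) (prim_z : m.-primitive_root z).

Lemma teich_map x : teich (f \o red) m z (f x) = teich red m z x.
Proof. by apply: eq_bigr => i _; rewrite /= (inj_eq (fmorph_inj f)). Qed.

Lemma brtr_map n (A : 'M_n) : A ^+ m = 1 ->
  brtr (f \o red) m z (map_mx f A) = brtr red m z A.
Proof.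
case/(finite_order_diag red mE prim_z) => P [d [uP -> d1]].
rewrite !map_mxM map_invmx map_diag_mx !brtr_diag //; last by rewrite map_unitmx.
by apply: eq_bigr => i _; rewrite mxE teich_map.
Qed.

End ChangeField.

Section Independence.

Variables (R : idomainType) (m : nat) (z : R).
Hypothesis prim_z : m.-primitive_root z.
Variables (p : nat) (gT : finGroupType) (G : {group gT}).
Hypothesis mG : (#|G|`_p^' %| m)%N.

Section OneField.

Variables (E : fieldType) (red : {rmorphism R -> E}).
Hypotheses (mE : m%:R != 0 :> E) (pE : p \in [pchar E]).
Local Notation reprG := (mx_representation E G).
Local Notation irrep := {n : nat & reprG n}.
Local Notation tr := (brtr red m z).

(** The Brauer character of [V], extended from the [p]-regular elements to the
    whole group through the [p']-part: its reduction is then the trace of [V]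
    everywhere, by [mxtrace_p'part]. *)
Definition brchar (V : irrep) : {ffun gT -> R} :=
  [ffun x => if x \in G then tr (tagged V x.`_p^') else 0].

Lemma repr_p'elt_unity n (rG : reprG n) x : x \in G -> rG x.`_p^' ^+ m = 1.
Proof.
move=> Gx; case: n rG => [|n] rG; first by apply/matrixP => -[].
rewrite -repr_mxX ?groupX //; apply: etrans (repr_mx1 rG); congr (rG _).
apply/eqP; rewrite -order_dvdn; apply: dvdn_trans mG.
by rewrite order_constt partn_dvd // order_dvdG.
Qed.

Lemma red_brchar V x : x \in G -> red (brchar V x) = \tr (tagged V x).
Proof.
move=> Gx; rewrite ffunE Gx (mxtrace_p'part _ pE Gx).
by rewrite (red_brtr red mE prim_z) // repr_p'elt_unity.
Qed.

(** The group algebra is mapped onto the full matrix algebra, which contains a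
    matrix unit of trace 1. *)
Lemma abs_irr_trace1 n (rG : reprG n) : mx_absolutely_irreducible rG ->
  exists b, \tr (gring_mx rG b) = 1.
Proof.
case/andP=> n_gt0 fullG; pose A : 'M[E]_n := delta_mx (Ordinal n_gt0) (Ordinal n_gt0).
have /submxP[b def_b] : (mxvec A <= enveloping_algebra_mx rG)%MS by apply: submx_full.
exists b; rewrite /gring_mx /= -def_b mxvecK /mxtrace (bigD1 (Ordinal n_gt0)) //=.
rewrite mxE !eqxx big1 ?addr0 // => i nei; by rewrite mxE (negPf nei).
Qed.

Lemma brchar_rsim n1 n2 (r1 : reprG n1) (r2 : reprG n2) :
  mx_rsim r1 r2 -> brchar (Tagged reprG r1) = brchar (Tagged reprG r2).
Proof.
move=> sim; apply/ffunP => x; rewrite !ffunE; case: ifP => //= Gx.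
case: sim => B def_n freeB homB; subst n2; rewrite row_free_unit in freeB.
suff -> : r2 x.`_p^' = invmx B *m r1 x.`_p^' *m B by rewrite /brtr char_poly_conj.
by rewrite -mulmxA homB ?groupX // mulKmx.
Qed.

(** The product of the elements given by [irr_separate] for each member of [s].
    Membership is [List.In] because representations have no decidable equality. *)
Lemma irr_separate_seq (V : irrep) (s : seq irrep) : mx_irreducible (tagged V) ->
    (forall W, List.In W s -> mx_irreducible (tagged W) /\ brchar W <> brchar V) ->
  exists e, gring_mx (tagged V) e = 1%:M /\
    (forall W, List.In W s -> gring_mx (tagged W) e = 0).
Proof.
move=> irrV; elim: s => [|W s IHs] irr_s.
  by exists (gring_row 1%:M); rewrite gring_mx1.
have [|e [e1 e0]] := IHs; first by move=> W' sW'; apply: irr_s; right.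
have [irrW nWV] := irr_s W (or_introl erefl).
have [|e' [e'1 e'0]] := @irr_separate E gT G _ _ (tagged V) (tagged W) irrV irrW.
  move=> sim; apply: nWV; rewrite -[W]taggedK -[V]taggedK.
  by symmetry; apply: brchar_rsim.
exists (e *m gring_mx (regular_repr E G) e'); split.
  by rewrite gring_mxA e1 e'1 mulmx1.
by move=> W' [<-|/e0 We0]; rewrite gring_mxA ?We0 ?e'0 ?mul0mx ?mulmx0.
Qed.

Lemma mxtrace_gring n (rG : reprG n) b :
  \tr (gring_mx rG b) = \sum_i b 0 i * \tr (rG (enum_val i)).
Proof.
by rewrite gring_mxE raddf_sum; apply: eq_bigr => i _; rewrite /= mxtraceZ.
Qed.

(** The filtration of [R] by the powers of its maximal ideal enters through
    this property only: a nonzero vector over [R] is a multiple of one that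
    does not vanish in the residue field. *)
Definition has_unimodular_multiples :=
  forall l (a : 'I_l -> R), (exists i, a i != 0) ->
  exists c (a' : 'I_l -> R),
    [/\ c != 0, forall i, a i = c * a' i & exists i, red (a' i) != 0].

Hypothesis redR : has_unimodular_multiples.

(** A linear relation can be rescaled until some coefficient is nonzero in the
    residue field.  Its reduction is a relation between traces, which extends by
    linearity to the group algebra, and an element that acts as the identity on one
    representation and as zero on the others then isolates that coefficient. *)
Lemma brchar_free_abs l (f : 'I_l -> {ffun gT -> R}) (a : 'I_l -> R) :
    injective f ->
    (forall i, exists2 V : irrep, mx_absolutely_irreducible (tagged V) & f i = brchar V) ->
    (forall x, x \in G -> \sum_i a i * f i x = 0) ->
  forall i, a i = 0.
Proof.
move=> injf /fin_all_exists2[V irrV fV] sum0 i0; apply/eqP.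
apply: contraT => nza; have [|c [a' [nzc def_a [i nza']]]] := redR (a := a).
  by exists i0.
have sum'0 x : x \in G -> \sum_j red (a' j) * \tr (tagged (V j) x) = 0.
  move=> Gx; apply: etrans (rmorph0 red).
  have /eqP : c * (\sum_j a' j * f j x) = 0.
    apply: etrans (sum0 _ Gx); rewrite mulr_sumr; apply: eq_bigr => j _.
    by rewrite def_a mulrA.
  rewrite mulf_eq0 (negPf nzc) => /eqP <-.
  rewrite rmorph_sum; apply: eq_bigr => j _.
  by rewrite rmorphM fV red_brchar.
have sum'0b b : \sum_j red (a' j) * \tr (gring_mx (tagged (V j)) b) = 0.
  under eq_bigr do rewrite mxtrace_gring mulr_sumr.
  rewrite exchange_big big1 //= => t _; under eq_bigr do rewrite mulrCA.
  by rewrite -mulr_sumr sum'0 ?mulr0 ?enum_valP.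
have [e [e1 e0]] : exists e, gring_mx (tagged (V i)) e = 1%:M /\
   (forall j, j != i -> gring_mx (tagged (V j)) e = 0).
  have [||e [e1 e0]] := @irr_separate_seq (V i) [seq V j | j <- enum 'I_l & j != i].
  - exact: mx_abs_irrW.
  - move=> W /List.in_map_iff[j [<- /List.filter_In[_ nji]]].
    split; first exact: mx_abs_irrW.
    by rewrite -!fV => /injf eji; rewrite eji eqxx in nji.
  exists e; split=> // j nji; apply: e0; apply/List.in_map_iff; exists j.
  split=> //; apply/List.filter_In; split=> //.
  elim: (enum 'I_l) (mem_enum 'I_l j) => //= j' s' IHs.
  by rewrite !inE => /orP[/eqP->|]; [left | move/IHs; right].
have [b b1] := abs_irr_trace1 (irrV i).
have := sum'0b (b *m gring_mx (regular_repr E G) e).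
rewrite (bigD1 i) //= gring_mxA e1 mulmx1 b1 mulr1 big1 ?addr0 => [a0|j nji].
  by rewrite a0 eqxx in nza'.
by rewrite gring_mxA e0 // mulmx0 linear0 mulr0.
Qed.

Lemma brtr_sub_fact n (rG : reprG n) (U : 'M_n) (modU : mxmodule rG U) x :
  x \in G -> tr (rG x) = tr (submod_mx modU x) + tr (factmod_mx modU x).
Proof.
move=> Gx; rewrite /brtr -big_split; apply: eq_bigr => i _ /=.
by rewrite (char_poly_sub_fact modU Gx) mupM ?monic_neq0 ?char_poly_monic // mulrnDr.
Qed.

(** The list [s] consists of the composition factors of [U], with multiplicity.
    All that is recorded of their relation to [U] is that elements of the group
    algebra acting on [U] as 0 or 1 act likewise on them. *)
Lemma brchar_factors n (U : reprG n) : exists s : seq irrep,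
  [/\ (0 < n)%N -> (0 < size s)%N,
      forall V, List.In V s -> mx_irreducible (tagged V) /\
        (forall e, (gring_mx U e = 0 -> gring_mx (tagged V) e = 0) /\
          (gring_mx U e = 1%:M -> gring_mx (tagged V) e = 1%:M)) &
      brchar (Tagged reprG U) = \sum_(V <- s) brchar V].
Proof.
have [r] := ubnP n; elim: r => // r IHr in n U *; rewrite ltnS => le_n_r.
have [n_gt0|n0] := ltnP 0 n; last first.
  exists [::]; split=> //; rewrite big_nil; apply/ffunP => x; rewrite !ffunE.
  case: ifP => // _; rewrite /brtr big1 // => i _.
  by rewrite mupNroot // -eigenvalue_root_char; apply/eigenvalueP => -[v _];
     rewrite -mxrank_eq0 -leqn0 (leq_trans (rank_leq_col v)).
have [irrU|redU] := classic (mx_irreducible U).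
  exists [:: Tagged reprG U]; rewrite big_seq1; split=> // V [<-|[]] /=.
  by split.
have [W [modW nzW NfullW]] : exists W : 'M_n, [/\ mxmodule U W, W != 0 & ~~ row_full W].
  apply: NNPP => noW; apply: redU; apply/mx_irrP; split=> // W modW nzW.
  by apply/negPn/negP => NfullW; apply: noW; exists W.
have rkW : (\rank W < n)%N by rewrite ltn_neqAle NfullW rank_leq_col.
have rkW' : (\rank (cokermx W) < n)%N.
  by rewrite mxrank_coker ltn_subrL n_gt0 lt0n mxrank_eq0 nzW.
have [|s1 [ne1 s1P U1]] := IHr _ (submod_repr modW); first exact: leq_trans le_n_r.
have [|s2 [ne2 s2P U2]] := IHr _ (factmod_repr modW); first exact: leq_trans le_n_r.
exists (s1 ++ s2); split=> [_|V|].
- by rewrite size_cat ltn_addr // ne1 // lt0n mxrank_eq0.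
- pose S := val_submod (1%:M : 'M_(\rank W)).
  pose F := val_factmod (1%:M : 'M_(\rank (cokermx W))).
  pose F' := in_factmod W (1%:M : 'M_n).
  have Se e : gring_mx (submod_repr modW) e *m S = S *m gring_mx U e.
    apply: gring_mx_hom => x Gx; by rewrite -val_submodE -val_submodJ // mul1mx.
  have Fe e : gring_mx (factmod_repr modW) e = F *m gring_mx U e *m F'.
    rewrite -mulmxA (@gring_mx_hom _ _ _ _ _ U (factmod_repr modW)).
      by rewrite mulmxA -in_factmodE val_factmodK mul1mx.
    by move=> x Gx; rewrite -in_factmodE -in_factmodJ // mul1mx.
  case/(@List.in_app_or _ s1 s2) => [/s1P | /s2P] [irrV annV]; split=> // e.
    have [a0 a1] := annV e; split=> Ue; [apply: a0 | apply: a1].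
      by apply: (@val_submod_inj _ _ W); rewrite val_submodE Se Ue mulmx0 linear0.
    by apply: (@val_submod_inj _ _ W); rewrite val_submodE Se Ue mulmx1.
  have [a0 a1] := annV e; split=> Ue; [apply: a0 | apply: a1].
    by rewrite Fe Ue mulmx0 mul0mx.
  by rewrite Fe Ue mulmx1 -in_factmodE val_factmodK.
rewrite big_cat -U1 -U2; apply/ffunP => x; rewrite !ffunE; case: ifP => Gx.
  by rewrite (brtr_sub_fact modW) // groupX.
by rewrite addr0.
Qed.

End OneField.

(** Over a splitting field [E'] of [G], distinct irreducible Brauer characters of
    [G] over [E] have disjoint sets of constituents, because an element of the
    group algebra over [E] acts as the identity on one and as zero on the other.
    The multiplicities, Schur indices included, are nonzero in the domain [R] of
    characteristic 0. *)
Lemma brchar_free (E : fieldType) (red : {rmorphism R -> E})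
    (l : nat) (W : 'I_l -> {n : nat & mx_representation E G n}) (a : 'I_l -> R) :
    m%:R != 0 :> E -> p \in [pchar E] -> (forall n, n.+1%:R != 0 :> R) ->
    has_unimodular_multiples red ->
    (forall i, mx_irreducible (tagged (W i))) ->
    injective (fun i => brchar red (W i)) ->
    (forall x, x \in G -> \sum_i a i * brchar red (W i) x = 0) ->
  forall i, a i = 0.
Proof.
move=> mE pE R0 redR irrW injW sum0 i0; apply/eqP.
apply: (@group_splitting_field_exists gT G E (a i0 == 0)) => -[E' iota splitE'].
pose red' : {rmorphism R -> E'} := iota \o red.
have mE' : m%:R != 0 :> E' by rewrite -(rmorph_nat iota) fmorph_eq0.
have pE' : p \in [pchar E'] by rewrite (fmorph_pchar iota).
have redR' : has_unimodular_multiples red'.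
  move=> l' a1 /redR[c [a' [nzc def_a [i nzi]]]]; exists c, a'; split=> //.
  by exists i; rewrite /= fmorph_eq0.
pose W' i := Tagged (mx_representation E' G) (map_repr iota (tagged (W i))).
have charW' i : brchar red' (W' i) = brchar red (W i).
  apply/ffunP => x; rewrite !ffunE; case: ifP => //= Gx.
  by rewrite map_reprE brtr_map // repr_p'elt_unity.
have [s sP] := fin_all_exists (fun i => brchar_factors red' (tagged (W' i))).
pose cs i := [seq brchar red' V | V <- s i].
pose fs := undup (flatten [seq cs i | i <- enum 'I_l]).
have fsP f : f \in fs ->
    exists2 V : {n : nat & mx_representation E' G n},
      mx_absolutely_irreducible (tagged V) & f = brchar red' V.
  rewrite mem_undup => /flatten_mapP[i _].
  have [_ irr_s _] := sP i; rewrite /cs; elim: (s i) irr_s => //= V s' IHs irr_s.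
  rewrite inE => /orP[/eqP-> | /IHs]; last by apply=> V' s'V'; apply: irr_s; right.
  by exists V => //; apply: splitE'; case: (irr_s V (or_introl erefl)).
have charWE i x : brchar red (W i) x =
    \sum_(f <- fs) (count_mem f (cs i))%:R * (f : {ffun gT -> R}) x.
  have [_ _ defW] := sP i; rewrite -charW' defW sum_ffunE.
  rewrite -(big_map (brchar red') xpredT (fun f => (f : {ffun gT -> R}) x)) -/(cs i).
  have sub_fs : {subset cs i <= fs}.
    move=> f csf; rewrite mem_undup; apply/flatten_mapP; exists i => //.
    by rewrite mem_enum.
  have : uniq fs by apply: undup_uniq.
  elim: (cs i) sub_fs => [|g cs' IHc] sub_fs ufs.
    by rewrite big_nil big1 // => f _; rewrite mul0r.
  rewrite big_cons IHc //; last by move=> f cs'f; apply: sub_fs; rewrite inE cs'f orbT.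
  rewrite [in RHS](eq_bigr (fun f : {ffun gT -> R} => (g == f)%:R * f x +
      (count_mem f cs')%:R * f x)); last first.
    by move=> f _ /=; rewrite natrD mulrDl.
  rewrite big_split /=; congr (_ + _).
  rewrite (bigD1_seq g) ?sub_fs ?mem_head //= eqxx mul1r big1 ?addr0 // => f nfg.
  by rewrite eq_sym (negPf nfg) mul0r.
have coef0 f : f \in fs -> \sum_i a i * (count_mem f (cs i))%:R = 0.
  move=> fs_f; pose F (j : 'I_(size fs)) := nth f fs j.
  have lt_f : (index f fs < size fs)%N by rewrite index_mem.
  have defF : F (Ordinal lt_f) = f by rewrite /F nth_index.
  rewrite -{1}defF.
  apply: (@brchar_free_abs _ _ mE' pE' redR' _ F
    (fun j => \sum_i a i * (count_mem (F j) (cs i))%:R)) => [j j' | j | x Gx].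
  - by move/eqP; rewrite nth_uniq ?undup_uniq // => /eqP/val_inj.
  - by apply: fsP; rewrite mem_nth.
  rewrite -[RHS](sum0 x Gx); under [RHS]eq_bigr do rewrite charWE mulr_sumr.
  rewrite exchange_big (big_nth f) big_mkord; apply: eq_bigr => j _ /=.
  by rewrite mulr_suml; apply: eq_bigr => i _; rewrite mulrA.
have [ne0 irr0 _] := sP i0; have /mx_irrP[n_gt0 _] := irrW i0.
case def_s: (s i0) (ne0 n_gt0) => [|V0 s0] // _.
have [|irrV0 annV0] := irr0 V0; first by rewrite def_s; left.
pose f0 := brchar red' V0.
have cs_f0 : f0 \in cs i0 by rewrite /cs def_s mem_head.
have fs_f0 : f0 \in fs.
  by rewrite mem_undup; apply/flatten_mapP; exists i0; rewrite ?mem_enum.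
have := coef0 f0 fs_f0; rewrite (bigD1 i0) //= big1 => [|i ni].
  move/eqP; rewrite addr0 mulf_eq0 => /orP[// | ].
  have : (0 < count_mem f0 (cs i0))%N by rewrite -has_count has_pred1.
  by case: (count_mem _ _) => // c _; rewrite (negPf (R0 c)).
rewrite (count_memPn _) ?mulr0 //; apply/negP => cs_if0.
have [V sV def_f0] : exists2 V, List.In V (s i) & f0 = brchar red' V.
  move: cs_if0; rewrite /cs; elim: (s i) => //= V s' IHs.
  rewrite inE => /orP[/eqP->|/IHs[V' s'V' ->]]; first by exists V; [left|].
  by exists V'; [right|].
have [_ /(_ V sV)[irrV annV] _] := sP i.
have [|e [e1 e0]] := irr_separate (irrW i0) (irrW i).
  by move/(brchar_rsim red); rewrite !taggedK => /injW ei; rewrite ei eqxx in ni.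
have mape j : gring_mx (tagged (W' j)) (map_mx iota e)
    = map_mx iota (gring_mx (tagged (W j)) e).
  by rewrite -map_gring_mx.
have /= V0e : gring_mx (tagged V0) (map_mx iota e) = 1%:M.
  by apply: (annV0 _).2; rewrite mape e1 map_mx1.
have /= Ve : gring_mx (tagged V) (map_mx iota e) = 0.
  by apply: (annV _).1; rewrite mape e0 map_mx0.
have [b b1] := abs_irr_trace1 (splitE' _ _ irrV0).
pose be := b *m gring_mx (regular_repr E' G) (map_mx iota e).
have : \tr (gring_mx (tagged V0) be) = \tr (gring_mx (tagged V) be).
  rewrite !mxtrace_gring; apply: eq_bigr => j _; congr (_ * _).
  by rewrite -!(red_brchar red' mE' pE') ?enum_valP // -/f0 def_f0.
rewrite !gring_mxA V0e Ve mulmx0 mulmx1 b1 linear0 => /eqP.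
by rewrite oner_eq0.
Qed.

End Independence.

(** * Divisibility of sums over groups *)

Section Divisibility.

Variable K : comNzRingType.

Local Notation integral := (integralOver (intr : int -> K)).

(** Requiring an algebraic integer as quotient keeps this divisibility meaningful
    when [n] is invertible in [K], as it is for [K] a local ring of residue
    characteristic prime to [n]. *)
Definition int_dvd (n : nat) (x : K) := exists2 y, integral y & x = y *+ n.

Lemma integralMn x n : integral x -> integral (x *+ n).
Proof.
move=> ix; rewrite -mulr_natr; apply: integral_mul => //; exact: integral_nat.
Qed.

Lemma integral_sum I (r : seq I) (P : pred I) F :
  (forall i, P i -> integral (F i)) -> integral (\sum_(i <- r | P i) F i).
Proof.
move=> iF; apply: (big_ind integral) => //; first exact: integral0.
exact: integral_add.
Qed.

Lemma int_dvd0 n : int_dvd n 0.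
Proof. by exists 0; [apply: integral0 | rewrite mul0rn]. Qed.

Lemma int_dvdD n x y : int_dvd n x -> int_dvd n y -> int_dvd n (x + y).
Proof.
move=> [u iu ->] [v iv ->]; exists (u + v); last by rewrite mulrnDl.
exact: integral_add.
Qed.

Lemma int_dvdB n x y : int_dvd n x -> int_dvd n y -> int_dvd n (x - y).
Proof.
move=> [u iu ->] [v iv ->]; exists (u - v); last by rewrite mulrnBl.
exact: integral_sub.
Qed.

Lemma int_dvd_sum n I (r : seq I) (P : pred I) F :
  (forall i, P i -> int_dvd n (F i)) -> int_dvd n (\sum_(i <- r | P i) F i).
Proof.
move=> iF; apply: (big_ind (int_dvd n)) => //; first exact: int_dvd0.
exact: int_dvdD.
Qed.

Lemma int_dvd_trans d n x : (d %| n)%N -> int_dvd n x -> int_dvd d x.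
Proof.
move=> /dvdnP[e ->] [y iy ->]; exists (y *+ e); first exact: integralMn.
by rewrite mulrnA.
Qed.

Lemma int_dvdMn n k x : int_dvd n x -> int_dvd (k * n) (x *+ k).
Proof. by case=> y iy ->; exists y; rewrite // -mulrnA mulnC. Qed.

(** Each orbit contributes its length times one value, and the length supplies
    the part of the group order that the stabiliser is missing. *)
Lemma int_dvd_orbit_sum (pi : nat_pred) (aT : finGroupType) (rT : finType)
    (to : {action aT &-> rT}) (J : {group aT}) (S : {set rT}) (w : rT -> K) :
    [acts J, on S | to] ->
    (forall o a, o \in S -> a \in J -> w (to o a) = w o) ->
    (forall o, o \in S -> int_dvd (#|'C_J[o | to]|`_pi) (w o)) ->
  int_dvd (#|J|`_pi) (\sum_(o in S) w o).
Proof.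
move=> actJ wJ w_dvd; rewrite (set_partition_big _ (orbit_partition actJ)) /=.
apply: int_dvd_sum => _ /imsetP[o So ->].
rewrite (eq_bigr (fun=> w o)) => [|_ /orbitP[a Ja <-]]; last exact: wJ.
rewrite sumr_const; apply: int_dvd_trans (int_dvdMn _ (w_dvd o So)).
rewrite -(card_orbit_stab to J o) partnM ?cardG_gt0 //; last first.
  by apply/card_gt0P; exists o; apply: orbit_refl.
by rewrite dvdn_mul // dvdn_part.
Qed.

(** Burnside's double count of the pairs of a group element and a fixed point. *)
Lemma int_dvd_fix_sum (pi : nat_pred) (aT : finGroupType) (rT : finType)
    (to : {action aT &-> rT}) (J : {group aT}) (S : {set rT}) (f : aT -> K) :
    [acts J, on S | to] -> {in J &, forall u a, f (u ^ a)%g = f u} ->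
    (forall o, o \in S ->
      int_dvd (#|'C_J[o | to]|`_pi) (\sum_(u in 'C_J[o | to]) f u)) ->
  int_dvd (#|J|`_pi) (\sum_(u in J) f u *+ #|'Fix_(S | to)[u]|).
Proof.
move=> actJ fJ f_dvd.
have -> : \sum_(u in J) f u *+ #|'Fix_(S | to)[u]|
    = \sum_(o in S) \sum_(u in 'C_J[o | to]) f u.
  under eq_bigr do rewrite -sumr_const.
  rewrite (exchange_big_dep (mem S)) /= => [|u o _]; last by case/setIP.
  apply: eq_bigr => o So; apply: eq_bigl => u.
  by rewrite 2!in_setI So /= (sameP afix1P astab1P).
apply: int_dvd_orbit_sum f_dvd => // o a So Ja.
rewrite (reindex_inj (conjg_inj a)) /=.
apply: eq_big => [u|u /setIP[]]; last by rewrite groupJr // => Ju _; apply: fJ.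
by rewrite !(in_setI _ (gval J)) groupJr // astab1_act memJ_conjg.
Qed.

Section Frobenius.

Variables (q : nat) (gT : finGroupType).
Hypothesis q_pr : prime q.

(** On the [q]-elements, the number [nu u] of fixed points of [u] on the cosets of
    a Sylow [q]-subgroup is prime to [q], so some power [nu ^ N] with [N > 0] is 1
    modulo [#|J|`_q].  Replacing [f] by [nu ^ N * f], which vanishes off the
    [q]-elements, changes the sum by a multiple of [#|J|`_q] and makes the
    hypothesis on [q]-subgroups applicable. *)
Lemma int_dvd_qelt_sum (J : {group gT}) (f : gT -> K) :
    {in J &, forall u a, f (u ^ a)%g = f u} -> {in J, forall u, integral (f u)} ->
    (forall T : {group gT}, T \subset J -> q.-group T ->
      int_dvd #|T| (\sum_(u in T) f u)) ->
  int_dvd (#|J|`_q) (\sum_(u in J | q.-elt u) f u).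
Proof.
move=> fJ f_int f_dvd; have [S sylS] := Sylow_exists q J.
pose X := rcosets S J; pose nu u := #|'Fix_(X | 'Rs)[u]|.
have actX : [acts J, on X | 'Rs] := actsRs_rcosets S J.
have nuJ u a : u \in J -> a \in J -> nu (u ^ a)%g = nu u.
  move=> Ju Ja; rewrite /nu -[RHS](card_imset _ (act_inj 'Rs a)); apply: eq_card => o.
  apply/idP/imsetP => [/setIP[Xo /afix1P fo] | [o' /setIP[Xo' /afix1P fo' ->]]].
    exists ('Rs%act o a^-1%g); last by rewrite actKV.
    rewrite inE (acts_act actX) ?groupV // Xo; apply/afix1P.
    have -> : 'Rs%act ('Rs%act o a^-1%g) u = 'Rs%act ('Rs%act o (u ^ a)%g) a^-1%g.
      by rewrite -!actM conjgE -!mulgA mulgV mulg1.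
    by rewrite fo.
  rewrite inE (acts_act actX) // Xo'; apply/afix1P.
  by rewrite -actM -conjgC actM fo'.
have stab_q o : o \in X -> q.-group 'C_J[o | 'Rs].
  case/rcosetsP=> x Jx ->; have sSJ := pHall_sub sylS.
  have tr := transRs_rcosets S J.
  have := card_orbit_stab 'Rs J (S :* x).
  have XSx : S :* x \in rcosets S J by apply/rcosetsP; exists x.
  rewrite (atransP tr _ XSx).
  rewrite -[#|rcosets S J|]/(#|J : S|) -(Lagrange sSJ) mulnC => /eqP.
  rewrite eqn_pmul2r ?indexg_gt0 // => /eqP cardC.
  by rewrite /pgroup cardC; apply: pHall_pgroup sylS.
have pow_nu N : {in J &, forall u a, f (u ^ a)%g *+ nu (u ^ a)%g ^ N = f u *+ nu u ^ N}
    /\ (forall T : {group gT}, T \subset J -> q.-group T ->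
         int_dvd #|T| (\sum_(u in T) f u *+ nu u ^ N)).
  split=> [u a Ju Ja|]; first by rewrite fJ ?nuJ.
  elim: N => [|N IHN] T sTJ qT; first by under eq_bigr do rewrite mulr1n; apply: f_dvd.
  rewrite -(part_pnat_id qT); under eq_bigr do rewrite expnSr mulrnA.
  apply: int_dvd_fix_sum => [|u a Tu Ta|o Xo].
  - exact: subset_trans sTJ actX.
  - by rewrite fJ ?nuJ ?(subsetP sTJ).
  have sCT : 'C_T[o | 'Rs] \subset T := subsetIl _ _.
  have qC := pgroupS sCT qT.
  by rewrite (part_pnat_id qC); apply: IHN => //; apply: subset_trans sTJ.
set a := (#|J|`_q)%N; pose N := (totient a).-1.
have a_gt0 : (0 < a)%N := part_gt0 _ _.
have dvd_sum : int_dvd a (\sum_(u in J) f u *+ nu u ^ N.+1).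
  under eq_bigr do rewrite expnSr mulrnA.
  apply: int_dvd_fix_sum => // [u b Ju Jb | o Xo]; first by rewrite fJ ?nuJ.
  have sCJ : 'C_J[o | 'Rs] \subset J := subsetIl _ _.
  by rewrite (part_pnat_id (stab_q o Xo)); apply: (pow_nu N).2; rewrite ?stab_q.
have nu_nq u : u \in J -> ~~ q.-elt u -> nu u = 0%N.
  move=> Ju; apply: contraNeq; rewrite -lt0n => /card_gt0P[o /setIP[Xo /afix1P fo]].
  by apply: mem_p_elt (stab_q o Xo) _; rewrite inE Ju; apply/astab1P.
have nu_cop u : u \in J -> q.-elt u -> coprime q (nu u).
  move=> Ju qu; rewrite prime_coprime //.
  have actu : [acts <[u]>, on X | 'Rs] by rewrite cycle_subG (subsetP actX).
  have := pgroup_fix_mod qu actu; rewrite afix_cycle -/(nu u) => e.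
  rewrite /dvdn -e -/(dvdn _ _) -[#|X|]/(#|J : S|) -p'natE //.
  by have /and3P[] := sylS.
have nu_q u : u \in J -> q.-elt u -> nu u ^ N.+1 = 1 %[mod a].
  move=> Ju qu; rewrite prednK ?totient_gt0 //; apply: Euler_exp_totient.
  by rewrite /a p_part coprime_sym coprimeXl ?nu_cop.
have -> : \sum_(u in J | q.-elt u) f u =
    \sum_(u in J) f u *+ nu u ^ N.+1 -
    \sum_(u in J | q.-elt u) (f u *+ nu u ^ N.+1 - f u).
  have -> : \sum_(u in J) f u *+ nu u ^ N.+1 =
      \sum_(u in J | q.-elt u) f u *+ nu u ^ N.+1.
    rewrite [RHS]big_mkcondr; apply: eq_bigr => u Ju.
    by case: ifPn => // /(nu_nq u Ju)->; rewrite exp0n.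
  by rewrite sumrB opprB addrC subrK.
apply: int_dvdB => //; apply: int_dvd_sum => u /andP[Ju qu].
have nu_gt0 : (0 < nu u ^ N.+1)%N.
  rewrite expn_gt0 lt0n; apply/orP; left; apply: contraTneq (nu_cop u Ju qu) => ->.
  by rewrite prime_coprime // dvdn0.
have -> : f u *+ nu u ^ N.+1 - f u = f u *+ (nu u ^ N.+1 - 1).
  by rewrite mulrnBr // mulr1n.
have /dvdnP[e ->] : (a %| nu u ^ N.+1 - 1)%N.
  by rewrite -eqn_mod_dvd //; apply/eqP/nu_q.
by exists (f u *+ e); [apply/integralMn/f_int | rewrite mulrnA].
Qed.

(** Write a [p]-regular element as [c * u] with [u] its [q]-part.  For fixed [c]
    the elements [u] are the [q]-elements of the centraliser of [c], and the
    resulting function of [c] is invariant under conjugation. *)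
Lemma int_dvd_p'elt_sum (p : nat) (J : {group gT}) (f : gT -> K) :
    prime p -> p != q ->
    {in J &, forall u a, f (u ^ a)%g = f u} -> {in J, forall u, integral (f u)} ->
    (forall c (T : {group gT}), c \in J -> p^'.-elt c -> T \subset 'C_J[c] -> q.-group T ->
      int_dvd #|T| (\sum_(u in T) f (c * u)%g)) ->
  int_dvd (#|J|`_q) (\sum_(a in J | p^'.-elt a) f a).
Proof.
move=> p_pr neq_pq fJ f_int f_dvd.
pose Cs := [set c in J | p^'.-elt c && q^'.-elt c].
rewrite (partition_big (fun a => a.`_q^') (mem Cs)) /=; last first.
  move=> a /andP[Ja p'a]; rewrite inE groupX // p_elt_constt andbT.
  by apply: mem_p_elt p'a _; apply: mem_cycle.
pose w c := \sum_(u in 'C_J[c] | q.-elt u) f (c * u)%g.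
rewrite (eq_bigr w) => [|c]; last first.
  rewrite inE => /and3P[Jc p'c q'c]; rewrite (reindex_inj (mulgI c)) /=.
  apply: eq_bigl => u; apply/idP/idP => [/andP[/andP[Jcu p'cu] /eqP def_c]|].
    have def_u : u = (c * u)%g.`_q.
      by apply: (mulgI c); rewrite -{1}(consttC q^' (c * u)%g) consttNK def_c.
    have Ju : u \in J by rewrite -(mulKg c u) groupM ?groupV.
    have cuc : commute u c.
      by rewrite def_u -[X in commute _ X]def_c; apply: commuteX2; apply: commute_refl.
    by rewrite inE Ju (introT cent1P cuc) def_u p_elt_constt.
  case/andP=> /setIP[Ju /cent1P cuc] qu; rewrite groupM //=.
  have q'p : p^'.-elt u.
    by apply: sub_p_elt qu => r; rewrite !inE => /eqP->; rewrite eq_sym.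
  have ccu : commute c u by apply: commute_sym.
  rewrite p_eltM //= consttM // (constt_p_elt q'c).
  by rewrite (constt1P _) ?mulg1 // p_eltNK.
have actJ : [acts J, on Cs | 'J].
  by apply/actsP => a Ja c; rewrite /= ![_ \in Cs]inE groupJr // !p_eltJ.
apply: (int_dvd_orbit_sum actJ) => [c a /setIdP[Jc _] Ja | c].
  rewrite /w (reindex_inj (conjg_inj a)) /=; apply: eq_big => [u|u /andP[/setIP[]]].
    by rewrite p_eltJ; congr (_ && _); rewrite !in_setI groupJr // cent1J memJ_conjg.
  by rewrite groupJr // => Ju _ _; rewrite -conjMg fJ ?groupM.
rewrite inE astab1J => /and3P[Jc p'c q'c]; apply: int_dvd_qelt_sum.
- move=> u a /setIP[Ju _] /setIP[Ja /cent1P cac].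
  have cJ : (c ^ a = c)%g by rewrite conjgE -cac mulKg.
  by rewrite -{1}cJ -conjMg fJ ?groupM.
- by move=> u /setIP[Ju _]; apply: f_int; rewrite groupM.
by move=> T sTC qT; apply: f_dvd.
Qed.

End Frobenius.

End Divisibility.

(** * Sums of Brauer characters over p-regular elements *)

Section BrauerSums.

Variables (R : idomainType) (E : fieldType) (red : {rmorphism R -> E}).
Variables (m : nat) (z : R) (p : nat) (gT : finGroupType).
Hypotheses (prim_z : m.-primitive_root z) (mE : m%:R != 0 :> E).

Local Notation tr := (brtr red m z).
Local Notation integral := (integralOver (intr : int -> R)).

Lemma brtr_integral n (A : 'M[E]_n) : integral (tr A).
Proof.
apply: integral_sum => i _; apply: integralMn.
have int_z : integral z.
  exists ('X^m - 1); first by rewrite monicXnsubC // (prim_order_gt0 prim_z).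
  by rewrite rmorphB rmorph1 /= map_polyXn rootE !hornerE (prim_expr_order prim_z) subrr.
elim: (i : nat) => [|j IHj]; first by rewrite expr0; apply: integral1.
by rewrite exprS; apply: integral_mul.
Qed.

Lemma brtr_trmx n (A : 'M[E]_n) : tr A^T = tr A.
Proof.
rewrite /brtr /char_poly -[\det (char_poly_mx A)]det_tr; congr (\sum_(i < m) _ *+ mup _ (\det _)).
by rewrite /char_poly_mx linearB /= tr_scalar_mx map_trmx.
Qed.

Section QGroup.

Variable q : nat.
Hypotheses (q_pr : prime q) (neq_pq : p != q).

(** Lift a nontrivial central element of the nontrivial [q]-group [T / N]. *)
Lemma qgroup_central_mod (T N : {group gT}) :
    q.-group T -> T \subset 'N(N) -> ~~ (T \subset N) ->
  exists u, [/\ u \in T, u \notin N & {in T, forall t, [~ u, t] \in N}%g].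
Proof.
move=> qT nNT sTN; have qTN := quotient_pgroup N qT.
have ntTN : (T / N)%g != 1%g by rewrite -subG1 quotient_sub1.
have ntZ : 'Z(T / N)%g != 1%g by rewrite (center_nil_eq1 (pgroup_nil qTN)).
have [ub Zub nt_ub] := trivgPn _ ntZ.
have /morphimP[u Nu Tu def_ub] : ub \in (T / N)%g := subsetP (center_sub _) _ Zub.
exists u; split=> // [|t Tt].
  by apply: contra nt_ub => uN; rewrite def_ub /= coset_id.
have Nt := subsetP nNT t Tt.
apply: coset_idr; rewrite ?groupR // morphR //= -def_ub; apply/eqP/commgP.
have /centerP[_ cub] := Zub; apply: cub; exact: mem_quotient.
Qed.

(** If [T] acts trivially, all terms are equal.  Otherwise an element [u] of [T]
    that is central modulo the kernel, but not in it, acts as a scalar different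
    from 1, by Schur's lemma and because its matrix has an eigenvalue in [E].  Then
    the translation by [u] multiplies the sum by the lift of this scalar, so the
    sum is 0. *)
Lemma irr_qgroup_brtr_sum (H T : {group gT}) n (W : mx_representation E H n) c :
    mx_irreducible W -> (#|H|`_p^' %| m)%N -> q.-group T -> T \subset 'C[c] ->
    c \in H -> T \subset H -> H \subset (<[c]> <*> T)%g -> p^'.-elt c ->
  int_dvd #|T| (\sum_(u in T) tr (W (c * u)%g)).
Proof.
move=> irrW mH qT cTc Hc sTH sHcT p'c.
have p'T : {in T, forall u, p^'.-elt u}.
  move=> u Tu; apply: sub_p_elt (mem_p_elt qT Tu) => r.
  by rewrite !inE => /eqP->; rewrite eq_sym.
have [sTK | nsTK] := boolP (T \subset rker W).
  rewrite (eq_bigr (fun=> tr (W c))) => [|u Tu].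
    by rewrite sumr_const; exists (tr (W c)) => //; apply: brtr_integral.
  have /rkerP[_ Wu] := subsetP sTK u Tu.
  by rewrite (repr_mxM W Hc (subsetP sTH u Tu)) Wu mulmx1.
have nKT : T \subset 'N(rker W) := subset_trans sTH (rker_norm W).
have [u [Tu nKu cTu]] := qgroup_central_mod qT nKT nsTK.
have Hu := subsetP sTH u Tu.
have cent_u : centgmx W (W u).
  have Tcent : T \subset rcent W (W u).
    apply/subsetP => t Tt; have Ht := subsetP sTH t Tt; rewrite inE Ht /=.
    have /rkerP[_ Wut] := cTu t Tt.
    by rewrite -!repr_mxM // {1}commgC (repr_mxM W (groupM Ht Hu) (groupR Hu Ht)) Wut mulmx1.
  have ccent : c \in rcent W (W u).
    have /cent1P cuc := subsetP cTc u Tu.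
    by rewrite inE Hc /= -!repr_mxM // cuc.
  apply: subset_trans sHcT _; rewrite join_subG Tcent andbT cycle_subG //.
have unity_H x : x \in H -> p^'.-elt x -> W x ^+ m = 1.
  by move=> Hx p'x; rewrite -(constt_p_elt p'x) repr_p'elt_unity.
have [P [d [uP defWu d1]]] := finite_order_diag red mE prim_z (unity_H u Hu (p'T u Tu)).
have /mx_irrP[n_gt0 _] := irrW; pose i0 := Ordinal n_gt0; pose a := d 0 i0.
have Wua : W u = a%:M.
  apply/eqP; rewrite -subr_eq0; apply: contraT => nz.
  have cent_ua : centgmx W (W u - a%:M).
    apply/centgmxP => x Hx; rewrite mulmxBl mulmxBr (centgmxP cent_u) //.
    by rewrite scalar_mxC.
  have u_ua := mx_Schur irrW cent_ua nz; pose v := row i0 P.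
  have v0 : v *m (W u - a%:M) = 0.
    have vP : v *m invmx P = delta_mx 0 i0 by rewrite /v rowE mulmxK.
    rewrite mulmxBr defWu !mulmxA vP -rowE row_diag_mx -scalemxAl -rowE.
    by rewrite mul_mx_scalar subrr.
  have : v = 0 by rewrite -(mulmxK u_ua v) v0 mul0mx.
  move/(congr1 (mulmxr (invmx P))); rewrite /= mul0mx /v rowE mulmxK //.
  by move/matrixP/(_ 0 i0)/eqP; rewrite !mxE !eqxx oner_eq0.
have a_unity : a ^+ m = 1 by apply: d1.
have na1 : teich red m z a != 1.
  apply: contra nKu => /eqP ta1; apply/rkerP; split=> //.
  by rewrite Wua -(red_teich red mE prim_z a_unity) ta1 rmorph1.
suff /eqP -> : \sum_(t in T) tr (W (c * t)%g) == 0 by exact: int_dvd0.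
set Sm := \sum_(t in T) _; have : Sm = teich red m z a * Sm.
  rewrite mulr_sumr /Sm (reindex_inj (mulgI u)) /=.
  apply: eq_big => [t|t]; first by rewrite groupMl.
  rewrite groupMl // => Tt; have Ht := subsetP sTH t Tt.
  have /cent1P cct := subsetP cTc t Tt.
  rewrite -(brtr_scale red mE prim_z a_unity); last first.
    apply: unity_H; rewrite ?groupM //.
    by rewrite p_eltM ?p'c ?p'T.
  congr (tr _); have /cent1P cuc := subsetP cTc u Tu.
  by rewrite mulgA -cuc -mulgA repr_mxM ?groupM // Wua mul_scalar_mx.
move/eqP; rewrite -subr_eq0 -{1}[Sm]mul1r -mulrBl mulf_eq0 subr_eq0 eq_sym.
by rewrite (negPf na1).
Qed.

(** Restrict [V] to the group generated by [c] and [T] and pass to the composition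
    factors of the restriction. *)
Lemma qgroup_brtr_sum (J T : {group gT}) n (V : mx_representation E J n) c :
    (#|J|`_p^' %| m)%N -> q.-group T -> T \subset 'C_J[c] -> c \in J ->
    p^'.-elt c ->
  int_dvd #|T| (\sum_(u in T) tr (V (c * u)%g)).
Proof.
rewrite subsetI => mJ qT /andP[sTJ cTc] Jc p'c.
pose H := (<[c]> <*> T)%G.
have sHJ : H \subset J by rewrite join_subG cycle_subG Jc.
have mH : (#|H|`_p^' %| m)%N.
  by apply: dvdn_trans mJ; rewrite partn_dvd // cardSg.
have Hc : c \in H by rewrite mem_gen // inE cycle_id.
have sTH : T \subset H by rewrite joing_subr.
have p'T u : u \in T -> p^'.-elt (c * u)%g.
  move=> Tu; have /cent1P cuc := subsetP cTc u Tu.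
  apply: p_eltM => //.
  apply: sub_p_elt (mem_p_elt qT Tu) => r.
  by rewrite !inE => /eqP->; rewrite eq_sym.
have brE n' (W : mx_representation E H n') u : u \in T ->
    tr (W (c * u)%g) = brchar m z p red (Tagged (mx_representation E H) W) (c * u)%g.
  move=> Tu; rewrite ffunE ifT ?groupM ?(subsetP sTH u Tu) //=.
  by rewrite (constt_p_elt (p'T u Tu)).
have [s [_ irr_s def_V]] := brchar_factors m z p red (subg_repr V sHJ).
rewrite (eq_bigr (fun u => \sum_(W <- s) tr (tagged W (c * u)%g))) => [|u Tu]; last first.
  rewrite (brE _ (subg_repr V sHJ)) // def_V sum_ffunE; apply: eq_bigr => W _.
  by rewrite brE // taggedK.
rewrite exchange_big /=; elim: s irr_s {def_V} => [|W s IHs] irr_s.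
  by rewrite big_nil; apply: int_dvd0.
rewrite big_cons; apply: int_dvdD; last by apply: IHs => W' sW'; apply: irr_s; right.
have [irrW _] := irr_s W (or_introl erefl).
by apply: irr_qgroup_brtr_sum irrW mH qT cTc Hc sTH _ p'c.
Qed.

(** The product is the Brauer character of [V1] tensored with the dual of [V2]. *)
Lemma int_dvd_brtr_product (J : {group gT}) n1 n2
    (V1 : mx_representation E J n1) (V2 : mx_representation E J n2) :
    prime p -> (#|J|`_p^' %| m)%N ->
  int_dvd (#|J|`_q) (\sum_(a in J | p^'.-elt a) tr (V1 a) * tr (V2 a^-1%g)).
Proof.
move=> p_pr mJ; pose V a := kron (V1 a) (V2 a^-1%g)^T.
have reprV : mx_repr J V.
  split=> [|a b Ja Jb]; rewrite /V ?invg1 ?repr_mx1 ?trmx1 ?kron1 //.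
  by rewrite invMg !repr_mxM ?groupV // trmx_mul kronM.
pose VJ := MxRepresentation reprV.
have unityJ n (W : mx_representation E J n) a :
    a \in J -> p^'.-elt a -> W a ^+ m = 1.
  by move=> Ja p'a; rewrite -(constt_p_elt p'a) repr_p'elt_unity.
have trX n (A : 'M[E]_n) k : A^T ^+ k = (A ^+ k)^T.
  elim: k => [|k IHk]; first by rewrite !expr0 -[1]/(1%:M) trmx1.
  by rewrite exprS exprSr IHk -!mulmxE trmx_mul.
rewrite (eq_bigr (fun a => tr (VJ a))) => [|a /andP[Ja p'a]]; last first.
  have Wa := unityJ _ V2 a^-1%g; rewrite groupV p_eltV in Wa.
  rewrite brtr_kron //; first by rewrite brtr_trmx.
    exact: unityJ.
  by rewrite trX Wa // trmx1.
apply: int_dvd_p'elt_sum p_pr neq_pq _ _ _ => // [u a Ju Ja|u _|c T Jc p'c sTC qT].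
- rewrite conjgE !repr_mxM ?groupM ?groupV // repr_mxV // mulmxA.
  rewrite /brtr char_poly_conj //; exact: repr_mx_unit.
- exact: brtr_integral.
exact: qgroup_brtr_sum.
Qed.

End QGroup.

End BrauerSums.

(** * Characters of split bismash products in characteristic 0 *)

Lemma mulmx_delta_entry (E : fieldType) n1 n2 n3 n4 (A : 'M[E]_(n1, n2))
    (C : 'M_(n3, n4)) i j k l : (A *m delta_mx i j *m C) k l = A k i * C j l.
Proof.
rewrite mxE (bigD1 j) //= mxE (bigD1 i) //= mxE !eqxx mulr1.
rewrite big1 ?addr0 => [|t nt]; last by rewrite mxE (negPf nt) mulr0.
rewrite big1 ?addr0 // => t nt; rewrite mxE big1 ?mul0r // => t' _.
by rewrite mxE (negPf nt) andbF mulr0.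
Qed.

Section Groupoid.

Variables (aT : finGroupType) (rT : finType) (act : {action aT &-> rT}).

Local Notation B := (rT * aT)%type.

(** The pair [(y, a)] is seen as the arrow from [y] to [act y a] of the
    transformation groupoid, whose algebra is the bismash product.  The inverse
    arrows [bdual u] form the basis dual to the arrows for the symmetrising form
    that takes the value 1 on the identity arrows and 0 on the others. *)
Definition bdual (u : B) : B := (act u.1 u.2, u.2^-1)%g.
Definition bconj (u : B) (c : aT) : B := (act u.1 c, u.2 ^ c)%g.
Definition bloop (u : B) := act u.1 u.2 == u.1.

Lemma sum_bbasis (V : nmodType) (f : B -> V) : \sum_u f u = \sum_b \sum_x f (x, b).
Proof. by rewrite exchange_big pair_bigA; apply: eq_bigr => -[]. Qed.

Lemma bdualK : involutive bdual.
Proof. by case=> y a; rewrite /bdual /= actK invgK. Qed.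

Lemma bloop_dual u : bloop (bdual u) = bloop u.
Proof. by rewrite /bloop /= actK eq_sym. Qed.

Lemma bloop_conj u c : bloop (bconj u c) = bloop u.
Proof.
by rewrite /bloop /= -actM conjgE mulKVg actM (inj_eq (act_inj act c)).
Qed.

Lemma bconjK c : cancel (bconj^~ c) (bconj^~ c^-1%g).
Proof. by case=> y a; rewrite /bconj /= actK conjgK. Qed.

Lemma bconjKV c : cancel (bconj^~ c^-1%g) (bconj^~ c).
Proof. by case=> y a; rewrite /bconj /= actKV conjgKV. Qed.

Lemma bdual_conj u c : bloop u -> bdual (bconj u c) = bconj (bdual u) c.
Proof.
case: u => y a; rewrite /bloop /bdual /bconj /= => /eqP ya.
by rewrite -!actM conjgE mulKVg conjVg !actM ya.
Qed.

Section Modules.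

Variable E : fieldType.
Hypothesis charE : forall n, n.+1%:R != 0 :> E.

Local Notation nF := (#|aT|%:R : E).

Let nF_neq0 : nF != 0.
Proof. by rewrite -cardsT -(prednK (cardG_gt0 [set: aT]%G)) charE. Qed.

(** Left modules are written as right actions on row vectors: [s u] is the
    transpose of the matrix of the basis element [u], hence the reversed order. *)
Definition hmod n (s : B -> 'M[E]_n) :=
  (forall u v, s v *m s u = if v.1 == act u.1 u.2 then s (u.1, u.2 * v.2)%g else 0)
  /\ \sum_x s (x, 1%g) = 1%:M.

Definition hinv n (s : B -> 'M[E]_n) m (A : 'M_(m, n)) := forall u, (A *m s u <= A)%MS.

Definition hsimple n (s : B -> 'M[E]_n) :=
  (0 < n)%N /\ forall A : 'M_n, hinv s A -> A != 0 -> row_full A.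

Definition hsplit n (s : B -> 'M[E]_n) :=
  forall A : 'M_n, (forall u, s u *m A = A *m s u) -> is_scalar_mx A.

Definition hchar n (s : B -> 'M[E]_n) : {ffun B -> E} := [ffun u => \tr (s u)].

(** Characters vanish off the loops, because an arrow that is not a loop is a
    product [e u] with [u e = 0], and they do not change when a loop is conjugated
    by an arrow. *)
Definition trace_like (f : {ffun B -> E}) :=
  (forall u, ~~ bloop u -> f u = 0) /\ (forall u c, bloop u -> f (bconj u c) = f u).

Lemma hmodM n (s : B -> 'M[E]_n) y a x b : hmod s ->
  s (y, a) *m s (x, b) = if y == act x b then s (x, b * a)%g else 0.
Proof. by case=> sM _; rewrite sM. Qed.

Lemma hchar_trace_like n (s : B -> 'M[E]_n) : hmod s -> trace_like (hchar s).
Proof.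
move=> hs; split=> [[y a]|[y a] c]; rewrite /bloop !ffunE /= => ya.
  have -> : s (y, a) = s (act y a, 1%g) *m s (y, a).
    by rewrite (hmodM _ _ _ _ hs) eqxx mulg1.
  by rewrite mxtrace_mulC (hmodM _ _ _ _ hs) act1 eq_sym (negPf ya) linear0.
have -> : s (bconj (y, a) c) = s (y, c) *m s (y, a) *m s (act y c, c^-1)%g.
  rewrite (hmodM _ _ _ _ hs) (eqP ya) eqxx (hmodM _ _ _ _ hs) actK eqxx.
  by rewrite /bconj /= conjgE.
by rewrite mxtrace_mulC mulmxA (hmodM _ _ _ _ hs) eqxx mulgV (hmodM _ _ _ _ hs) (eqP ya) eqxx mulg1.
Qed.

(** The sum over dual bases that turns any matrix into a homomorphism of modules. *)
Definition casimir n1 n2 (s1 : B -> 'M[E]_n1) (s2 : B -> 'M[E]_n2) X :=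
  \sum_u s1 u *m X *m s2 (bdual u).

Lemma casimir_hom n1 n2 (s1 : B -> 'M[E]_n1) (s2 : B -> 'M[E]_n2) X v :
  hmod s1 -> hmod s2 ->
  s1 v *m casimir s1 s2 X = casimir s1 s2 X *m s2 v.
Proof.
case: v => y a hs1 hs2; rewrite /casimir mulmx_sumr mulmx_suml.
transitivity (\sum_b s1 (act y b^-1, b * a)%g *m X *m s2 (y, b^-1)%g).
  rewrite sum_bbasis; apply: eq_bigr => b _ /=.
  rewrite (bigD1 (act y b^-1%g)) //= big1 ?addr0 => [|x nx].
    by rewrite !mulmxA (hmodM _ _ _ _ hs1) /bdual /= actKV eqxx.
  rewrite !mulmxA (hmodM _ _ _ _ hs1) ifF ?mul0mx //.
  by apply: contraNF nx => /eqP ->; rewrite actK.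
rewrite sum_bbasis [RHS](reindex_inj (mulIg a)) /=; apply: eq_bigr => b _.
rewrite (bigD1 (act y b^-1%g)) //= big1 ?addr0 => [|x nx].
  rewrite -[RHS]mulmxA /bdual /= (hmodM _ _ _ _ hs2) -actM mulKg eqxx.
  by rewrite invMg mulKVg.
rewrite -mulmxA (hmodM _ _ _ _ hs2) ifF ?mulmx0 //.
apply: contraNF nx => /eqP /(congr1 (act^~ (b * a)^-1%g)).
by rewrite /= actK => ->; rewrite -actM invMg mulKVg.
Qed.

(** Schur's lemma: the homomorphism [X] is an isomorphism. *)
Lemma hsimple_hom n1 n2 (s1 : B -> 'M[E]_n1) (s2 : B -> 'M[E]_n2) (X : 'M_(n1, n2)) :
    hsimple s1 -> hsimple s2 -> (forall u, s1 u *m X = X *m s2 u) -> X != 0 ->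
  hchar s1 = hchar s2.
Proof.
move=> [n1_gt0 irr1] [n2_gt0 irr2] homX nzX.
have freeX : row_free X.
  rewrite -kermx_eq0; apply: contraNT nzX => nzK.
  have /irr1/(_ nzK) fullK : hinv s1 (kermx X).
    by move=> u; apply/sub_kermxP; rewrite -mulmxA homX mulmxA mulmx_ker mul0mx.
  by rewrite -(mul1mx X); apply/eqP/sub_kermxP; rewrite sub1mx.
have fullX : row_full X.
  rewrite /row_full -genmxE; apply: irr2; last by rewrite (eqmx_eq0 (genmxE _)).
  by move=> u; rewrite (eqmxMr _ (genmxE _)) genmxE -homX submxMl.
have def_n : n1 = n2 by rewrite -(eqP freeX) (eqP fullX).
case: n2 / def_n in s2 X {irr2 n2_gt0} homX nzX freeX fullX *.
apply/ffunP => u; rewrite !ffunE; rewrite row_free_unit in freeX.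
by rewrite -[s1 u](mulmxK freeX) homX mxtrace_mulC mulKmx.
Qed.

Lemma hchar_dot n1 n2 (s1 : B -> 'M[E]_n1) (s2 : B -> 'M[E]_n2) :
  \sum_u hchar s1 u * hchar s2 (bdual u) =
  \sum_i \sum_j casimir s1 s2 (delta_mx i j) i j.
Proof.
under eq_bigr do rewrite !ffunE /mxtrace mulr_suml.
rewrite exchange_big; apply: eq_bigr => i _ /=.
under eq_bigr do rewrite mulr_sumr.
rewrite exchange_big; apply: eq_bigr => j _ /=.
rewrite /casimir summxE; apply: eq_bigr => u _.
by rewrite mulmx_delta_entry.
Qed.

Lemma hchar_orth n1 n2 (s1 : B -> 'M[E]_n1) (s2 : B -> 'M[E]_n2) :
    hmod s1 -> hmod s2 -> hsimple s1 -> hsimple s2 -> hchar s1 != hchar s2 ->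
  \sum_u hchar s1 u * hchar s2 (bdual u) = 0.
Proof.
move=> hs1 hs2 irr1 irr2 ne12; rewrite hchar_dot big1 // => i _; rewrite big1 // => j _.
suff -> : casimir s1 s2 (delta_mx i j) = 0 by rewrite mxE.
apply/eqP; apply: contraR ne12 => nzC; apply/eqP.
by apply: hsimple_hom irr1 irr2 _ nzC => u; apply: casimir_hom.
Qed.

Lemma casimir_scalar n (s : B -> 'M[E]_n) X : hmod s -> hsimple s -> hsplit s ->
  casimir s s X = (nF * \tr X / n%:R)%:M.
Proof.
move=> hs [n_gt0 _] splits.
have /is_scalar_mxP[c defC] : is_scalar_mx (casimir s s X).
  by apply: splits => u; apply: casimir_hom.
have n0 : n%:R != 0 :> E by rewrite -(prednK n_gt0) charE.
rewrite defC; congr (_%:M); apply: (mulIf n0); rewrite mulfVK //.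
have := congr1 mxtrace defC; rewrite mxtrace_scalar mulr_natr => <-.
rewrite raddf_sum /=.
under eq_bigr do rewrite mxtrace_mulC mulmxA.
rewrite -raddf_sum -mulmx_suml /=.
suff -> : \sum_u s (bdual u) *m s u = nF%:M by rewrite mul_scalar_mx mxtraceZ.
rewrite -scalemx1 -(proj2 hs) scaler_sumr.
transitivity (\sum_(u : B) s (u.1, 1%g)).
  by apply: eq_bigr => -[y a] _; rewrite (hmodM _ _ _ _ hs) eqxx mulgV.
rewrite sum_bbasis exchange_big; apply: eq_bigr => x _ /=.
by rewrite sumr_const scaler_nat cardE.
Qed.

Lemma hchar_norm n (s : B -> 'M[E]_n) : hmod s -> hsimple s -> hsplit s ->
  \sum_u hchar s u * hchar s (bdual u) = nF.
Proof.
move=> hs irrs splits; rewrite hchar_dot.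
have n0 : n%:R != 0 :> E by have [n_gt0 _] := irrs; rewrite -(prednK n_gt0) charE.
rewrite (eq_bigr (fun=> nF / n%:R)) => [|i _]; last first.
  rewrite (bigD1 i) //= big1 ?addr0 => [|j nj]; rewrite casimir_scalar // mxE.
    rewrite eqxx (_ : \tr (delta_mx i i) = 1) ?mulr1 // /mxtrace (bigD1 i) //=.
    by rewrite mxE !eqxx big1 ?addr0 // => l nl; rewrite mxE (negPf nl).
  by rewrite eq_sym (negPf nj).
by rewrite sumr_const card_ord -[LHS]mulr_natr mulfVK.
Qed.

Definition hop n (s : B -> 'M[E]_n) (f : {ffun B -> E}) := \sum_u f u *: s u.

(** Without semisimplicity, the trace still only sees the composition factors: this
    is an induction on the dimension, through a proper submodule and its quotient. *)
Lemma hop_trace0 (f : {ffun B -> E}) :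
    (forall n (s : B -> 'M[E]_n), hmod s -> hsimple s -> hop s f = 0) ->
  forall n (s : B -> 'M[E]_n) v, hmod s -> \tr (hop s f *m s v) = 0.
Proof.
move=> f0 n s v hs; have [r] := ubnP n.
elim: r => // r IHr in n s v hs *; rewrite ltnS => le_n_r.
have [n_gt0|n0] := ltnP 0 n; last first.
  rewrite /mxtrace big1 // => i; have := leq_trans (ltn_ord i) n0; by [].
have [irrs|redS] := classic (hsimple s); first by rewrite f0 // mul0mx linear0.
have [W [invW nzW NfullW]] : exists W : 'M_n, [/\ hinv s W, W != 0 & ~~ row_full W].
  apply: NNPP => noW; apply: redS; split=> // W invW nzW.
  by apply/negPn/negP => NfullW; apply: noW; exists W.
have rkW : (\rank W < n)%N by rewrite ltn_neqAle NfullW rank_leq_col.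
have rkW' : (\rank (cokermx W) < n)%N.
  by rewrite mxrank_coker ltn_subrL n_gt0 lt0n mxrank_eq0 nzW.
pose S := val_submod (1%:M : 'M_(\rank W)); pose S' := in_submod W 1%:M.
pose T := val_factmod (1%:M : 'M_(\rank (cokermx W))); pose T' := in_factmod W 1%:M.
have SS : S *m S' = 1%:M by rewrite -in_submodE val_submodK.
have TT : T *m T' = 1%:M by rewrite -in_factmodE val_factmodK.
have SST k (A : 'M_(k, n)) : (A <= W)%MS -> A *m S' *m S = A.
  by move=> sAW; rewrite -in_submodE -val_submodE in_submodK.
have WT k (A : 'M_(k, n)) : (A <= W)%MS -> A *m T' = 0.
  by move=> sAW; rewrite -in_factmodE; apply/eqP; rewrite in_factmod_eq0.
have sSW : (S <= W)%MS by apply: val_submodP.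
have Ss u : (S *m s u <= W)%MS by apply: submx_trans (submxMr _ sSW) (invW u).
have decomp : S' *m S + T' *m T = 1%:M.
  rewrite -[in RHS](add_sub_fact_mod W 1%:M).
  by rewrite [val_submod _]val_submodE [val_factmod _]val_factmodE.
clearbody S S' T T'.
have Ts u : T' *m T *m s u *m T' = s u *m T'.
  rewrite -[in RHS](mul1mx (s u)) -decomp mulmxDl mulmxDl.
  by rewrite -!(mulmxA S') (WT _ _ (Ss u)) mulmx0 add0r.
pose s1 u := S *m s u *m S'; pose s2 u := T *m s u *m T'.
have hs1 : hmod s1.
  split=> [u w|].
    rewrite /s1 !mulmxA SST // -(mulmxA S) (proj1 hs).
    by case: ifP => // _; rewrite mulmx0 mul0mx.
  by rewrite -mulmx_suml -mulmx_sumr (proj2 hs) mulmx1.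
have hs2 : hmod s2.
  split=> [u w|].
    rewrite /s2 -(mulmxA (T *m s w)) !(mulmxA T') Ts mulmxA -(mulmxA T) (proj1 hs).
    by case: ifP => // _; rewrite mulmx0 mul0mx.
  by rewrite -mulmx_suml -mulmx_sumr (proj2 hs) mulmx1.
have tr_split u : \tr (s u) = \tr (s1 u) + \tr (s2 u).
  rewrite -[s u]mulmx1 -decomp mulmxDr linearD /=; congr (_ + _).
    by rewrite mulmxA mxtrace_mulC mulmxA.
  by rewrite mulmxA mxtrace_mulC mulmxA.
have := IHr _ s1 v hs1 (leq_trans rkW le_n_r).
have := IHr _ s2 v hs2 (leq_trans rkW' le_n_r).
rewrite /hop !mulmx_suml !linear_sum /= => e2 e1.
have := congr2 +%R e1 e2; rewrite addr0 -big_split /= => e12.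
apply: etrans e12; apply: eq_bigr => u _.
rewrite -!scalemxAl !linearZ /= -mulrDr; congr (_ * _).
rewrite (proj1 hs) (proj1 hs1) (proj1 hs2); case: ifP => _; first exact: tr_split.
by rewrite !linear0 addr0.
Qed.

Definition hregular (u : B) : 'M[E]_#|{: B}| :=
  \matrix_i (if (enum_val i).1 == act u.1 u.2
               then delta_mx 0 (enum_rank (u.1, u.2 * (enum_val i).2)%g) else 0).

Lemma hregular_hmod : hmod hregular.
Proof.
split=> [u v|].
  apply/row_matrixP => i; rewrite row_mul rowK.
  case: ifP => [/eqP ev | nev]; last first.
    rewrite mul0mx; case: ifP => [|_]; last by rewrite row0.
    by move/eqP => v1; rewrite rowK /= actM -v1 nev.
  rewrite -rowE rowK enum_rankK /=; case: ifP => /eqP v1; last by rewrite row0.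
  by rewrite rowK /= actM -v1 ev eqxx mulgA.
apply/row_matrixP => i; rewrite linear_sum /=.
under eq_bigr do rewrite rowK /= act1.
rewrite (bigD1 (enum_val i).1) //= eqxx big1 ?addr0 => [|x nx].
  by rewrite mul1g -surjective_pairing enum_valK row1.
by rewrite eq_sym (negPf nx).
Qed.

(** This trace is the symmetrising form, up to the factor [#|aT|]. *)
Lemma mxtrace_hregular u : \tr (hregular u) = (u.2 == 1%g)%:R * nF.
Proof.
rewrite /mxtrace; case: u => y a /=.
transitivity (\sum_(w : B) ((w.1 == act y a) && (w == (y, a * w.2)%g))%:R : E).
  rewrite (reindex_onto enum_rank enum_val) => [|i _]; last exact: enum_valK.
  rewrite (eq_bigl xpredT) => [|w]; last by rewrite enum_rankK eqxx.
  apply: eq_bigr => w _; rewrite /hregular mxE enum_rankK /=.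
  by case: ifP => _; rewrite mxE ?eqxx //= (inj_eq enum_rank_inj).
rewrite sum_bbasis; have [->|na] := eqVneq a 1%g.
  rewrite mul1r -sum1_card natr_sum; apply: eq_bigr => b _.
  rewrite (bigD1 y) //= act1 mul1g !eqxx big1 ?addr0 // => x nx.
  by rewrite (negPf nx).
rewrite mul0r big1 // => b _; rewrite big1 // => x _.
by rewrite xpair_eqE /= -{1}[b]mul1g (inj_eq (mulIg b)) [1%g == a]eq_sym (negPf na) !andbF.
Qed.

(** The element [\sum_u f (bdual u) u] is central, so it acts on a simple module
    as a scalar that the orthogonality hypothesis forces to be 0; the coefficients
    of an element can be read off from the traces of its multiples in the regular
    module. *)
Lemma trace_like_complete (f : {ffun B -> E}) : trace_like f ->
    (forall n (s : B -> 'M[E]_n), hmod s -> hsimple s -> hsplit s) ->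
    (forall n (s : B -> 'M[E]_n), hmod s -> hsimple s ->
      \sum_u f u * hchar s (bdual u) = 0) ->
  f = 0.
Proof.
move=> [f_loop f_conj] allsplit f_orth.
pose fd : {ffun B -> E} := [ffun u => f (bdual u)].
have central n (s : B -> 'M[E]_n) v : hmod s -> s v *m hop s fd = hop s fd *m s v.
  case: v => y b hs; rewrite /hop mulmx_sumr mulmx_suml !sum_bbasis.
  transitivity (\sum_c f (y, c^-1)%g *: s (act y c^-1, c * b)%g).
    apply: eq_bigr => c _; rewrite (bigD1 (act y c^-1%g)) //= big1 ?addr0 => [|x nx].
      by rewrite -scalemxAr (hmodM _ _ _ _ hs) ffunE /bdual /= actKV eqxx.
    rewrite -scalemxAr (hmodM _ _ _ _ hs) ifF ?scaler0 //.
    by apply: contraNF nx => /eqP ->; rewrite actK.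
  rewrite (reindex_inj (conjg_inj b^-1%g)); apply: eq_bigr => c _ /=.
  rewrite (bigD1 (act y b)) //= big1 ?addr0 => [|x nx]; last first.
    by rewrite -scalemxAl (hmodM _ _ _ _ hs) (negPf nx) scaler0.
  rewrite -scalemxAl (hmodM _ _ _ _ hs) eqxx ffunE /bdual /=.
  have -> : (c ^ b^-1 * b = b * c)%g by rewrite conjgE invgK !mulgA mulgKV.
  pose w := (y, (c ^ b^-1)^-1)%g; have def_w : bconj w b = (act y b, c^-1)%g.
    by rewrite /bconj /= conjVg conjgKV.
  have [loopw|nloopw] := boolP (bloop w).
    rewrite -[f (y, _)](f_conj w b loopw) def_w.
    move: (loopw); rewrite -(bloop_conj w b) def_w /bloop /= => /eqP/(canRL (actKV act c)) <-.
    by move/eqP: loopw => /= ->.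
  rewrite (f_loop w) // f_loop ?scale0r //.
  rewrite -(bloop_dual) /bdual /= actK invgK; apply: contra nloopw.
  by rewrite -(bloop_conj w b) def_w /bloop /= => /eqP e; rewrite -{1}e actK.
have fd0 n (s : B -> 'M[E]_n) : hmod s -> hsimple s -> hop s fd = 0.
  move=> hs irrs; have splits := allsplit _ _ hs irrs.
  have /is_scalar_mxP[c def_c] : is_scalar_mx (hop s fd).
    by apply: splits => u; apply: central.
  have n0 : n%:R != 0 :> E by have [n_gt0 _] := irrs; rewrite -(prednK n_gt0) charE.
  have := congr1 mxtrace def_c; rewrite mxtrace_scalar linear_sum /=.
  under eq_bigr do rewrite mxtraceZ.
  rewrite (reindex_inj (inv_inj bdualK)) /= => tr0.
  have : c *+ n = 0.
    rewrite -tr0 -[RHS](f_orth _ _ hs irrs); apply: eq_bigr => u _.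
    by rewrite !ffunE bdualK.
  move/eqP; rewrite -mulr_natr mulf_eq0 (negPf n0) orbF => /eqP c0.
  by rewrite def_c c0; apply: raddf0.
apply/ffunP => u; rewrite ffunE; apply: (mulIf nF_neq0); rewrite mul0r.
have := hop_trace0 fd0 u hregular_hmod; rewrite /hop mulmx_suml linear_sum /= => <-.
rewrite (bigD1 (bdual u)) //= big1 ?addr0 => [|w nw].
  rewrite ffunE bdualK -scalemxAl mxtraceZ (proj1 hregular_hmod) eqxx.
  by rewrite mxtrace_hregular /= mulgV eqxx mul1r.
rewrite -scalemxAl mxtraceZ (proj1 hregular_hmod); case: eqP => e; last by rewrite linear0 mulr0.
rewrite mxtrace_hregular /=; case: eqP => e2; last by rewrite mul0r mulr0.
case/eqP: nw; case: w e e2 => x c; case: u => y a /= e e2.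
by rewrite /bdual /= e; congr (_, _); apply: (mulgI a); rewrite mulgV.
Qed.

Definition hirr_char (f : {ffun B -> E}) :=
  exists n (s : B -> 'M[E]_n), [/\ hmod s, hsimple s & f = hchar s].

Hypothesis allsplit : forall n (s : B -> 'M[E]_n), hmod s -> hsimple s -> hsplit s.

Lemma hirr_char_dot f g : hirr_char f -> hirr_char g ->
  \sum_u f u * g (bdual u) = (f == g)%:R * nF.
Proof.
move=> [n1 [s1 [hs1 irr1 ->]]] [n2 [s2 [hs2 irr2 ->]]].
have [e|ne] := eqVneq; last by rewrite mul0r hchar_orth.
by rewrite mul1r e hchar_norm //; apply: allsplit.
Qed.

(** Row orthogonality makes the matrix of values of [fs] right invertible. *)
Lemma hirr_char_size (fs : seq {ffun B -> E}) :
  uniq fs -> (forall f, f \in fs -> hirr_char f) -> (size fs <= #|{: B}|)%N.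
Proof.
move=> ufs irr_fs.
pose X := \matrix_(i < size fs, j < #|{: B}|) (nth 0 fs i) (enum_val j).
pose X' := \matrix_(j < #|{: B}|, i < size fs) (nth 0 fs i) (bdual (enum_val j)).
have XX : X *m X' = nF%:M.
  apply/matrixP => i j; rewrite !mxE.
  under eq_bigr do rewrite !mxE.
  rewrite -(big_enum_val (fun u => (nth 0 fs i) u * (nth 0 fs j) (bdual u))) /=.
  rewrite hirr_char_dot; try by apply: irr_fs; rewrite mem_nth.
  by rewrite nth_uniq // (inj_eq val_inj); case: (i == j); rewrite ?mul1r ?mul0r.
have := mxrankM_maxl X X'; rewrite XX -scalemx1 mxrank_scale_nz // mxrank1 => le.
exact: leq_trans le (rank_leq_col X).
Qed.

Lemma hirr_char_finite :
  exists2 fs : seq {ffun B -> E}, uniq fs & forall f, f \in fs <-> hirr_char f.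
Proof.
apply: NNPP => no_fs.
suff /(_ #|{: B}|.+1)[fs [ufs irr_fs szfs]] : forall N, exists fs : seq {ffun B -> E},
    [/\ uniq fs, forall f, f \in fs -> hirr_char f & size fs = N].
  by have := hirr_char_size ufs irr_fs; rewrite szfs ltnn.
elim=> [|N [fs [ufs irr_fs szfs]]]; first by exists [::].
have [f [irr_f nf]] : exists f, hirr_char f /\ f \notin fs.
  apply: NNPP => all_f; apply: no_fs; exists fs => // f; split; first exact: irr_fs.
  by move=> irr_f; apply: contraT => nf; case: all_f; exists f.
exists (f :: fs); split; rewrite /= ?nf ?szfs // => g.
by rewrite inE => /orP[/eqP->|/irr_fs].
Qed.

(** The two sides agree because their difference is orthogonal to every
    irreducible character. *)
Lemma hirr_char_column_orth (fs : seq {ffun B -> E}) u v :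
    uniq fs -> (forall f, f \in fs <-> hirr_char f) -> bloop u ->
  \sum_(f <- fs) f (bdual u) * f v = \sum_c (bconj u c == v)%:R.
Proof.
move=> ufs fsP loopu.
pose d : {ffun B -> E} := [ffun w =>
  \sum_c (bconj u c == w)%:R - \sum_(f <- fs) f (bdual u) * f w].
have hirr_like f : hirr_char f -> trace_like f.
  by move=> [n [s [hs _ ->]]]; apply: hchar_trace_like.
suff d0 : d = 0.
  have /eqP := congr1 (fun f : {ffun B -> E} => f v) d0; rewrite !ffunE subr_eq0.
  by move/eqP.
apply: trace_like_complete => //.
  split=> [w nlw|w c lw]; rewrite !ffunE.
    rewrite big1 => [|c _]; last first.
      by case: eqP => // e; case/negP: nlw; rewrite -e bloop_conj.
    rewrite big_seq big1 ?subr0 // => f /fsP/hirr_like[f0 _].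
    by rewrite (f0 w) ?mulr0.
  congr (_ - _).
    rewrite (reindex_inj (mulIg c)) /=; apply: eq_bigr => a _.
    by rewrite -(inj_eq (can_inj (bconjK c)) (bconj u a)) /bconj /= actM conjgM.
  rewrite big_seq [RHS]big_seq; apply: eq_bigr => f /fsP/hirr_like[_ fc].
  by rewrite fc.
move=> n s hs irrs; set x := hchar s.
have irrx : hirr_char x by exists n, s.
have [_ x_conj] := hirr_like x irrx.
under eq_bigr do rewrite ffunE mulrBl !mulr_suml.
rewrite sumrB exchange_big [X in _ - X]exchange_big /=; apply/eqP; rewrite subr_eq0.
rewrite (eq_bigr (fun=> x (bdual u))) => [|c _]; last first.
  rewrite (bigD1 (bconj u c)) //= eqxx mul1r big1 ?addr0 => [|w nw].
    by rewrite bdual_conj // x_conj // bloop_dual.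
  by rewrite eq_sym (negPf nw) mul0r.
have fs_x : x \in fs by apply/fsP.
rewrite sumr_const (bigD1_seq x fs_x ufs) /= [X in _ + X]big1_seq ?addr0 => [|f].
  under eq_bigr do rewrite -mulrA.
  by rewrite -mulr_sumr hirr_char_dot // eqxx mul1r mulr_natr.
case/andP=> nf /fsP irrf; under eq_bigr do rewrite -mulrA.
by rewrite -mulr_sumr hirr_char_dot // (negPf nf) mul0r mulr0.
Qed.

End Modules.

Section ExtendScalars.

Variables (E E' : fieldType) (j : {rmorphism E -> E'}).
Hypothesis charE : forall n, n.+1%:R != 0 :> E.

Let charE' n : n.+1%:R != 0 :> E'.
Proof. by rewrite -(rmorph_nat j) fmorph_eq0. Qed.

Lemma map_hmod n (s : B -> 'M[E]_n) : hmod s -> hmod (fun u => map_mx j (s u)).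
Proof.
move=> [sM s1]; split=> [u v|].
  by rewrite -map_mxM sM; case: ifP => // _; rewrite map_mx0.
by rewrite -(map_mx1 j) -s1 raddf_sum.
Qed.

(** The Schur relations exhibit the matrix units as combinations of the [s u],
    so simplicity survives the extension of scalars. *)
Lemma map_hsimple n (s : B -> 'M[E]_n) : hmod s -> hsimple s -> hsplit s ->
  hsimple (fun u => map_mx j (s u)).
Proof.
move=> hs irrs splits; have [n_gt0 _] := irrs; split=> // A invA nzA.
have n0 : n%:R != 0 :> E by rewrite -(prednK n_gt0) charE.
have nF0 : #|aT|%:R != 0 :> E.
  by rewrite -cardsT -(prednK (cardG_gt0 [set: aT]%G)) charE.
pose c : E' := j (#|aT|%:R / n%:R).
have nzc : c != 0 by rewrite fmorph_eq0 mulf_neq0 ?invr_eq0.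
have unitE (i l k k' : 'I_n) : \sum_u map_mx j (s u) k i * map_mx j (s (bdual u)) k' l
    = c * (i == k')%:R * (k == l)%:R.
  have := congr1 (fun M : 'M_n => j (M k l)) (casimir_scalar charE (delta_mx i k') hs irrs splits).
  rewrite /casimir summxE rmorph_sum mxE rmorphMn /= => e.
  transitivity (j (#|aT|%:R * \tr (delta_mx i k') / n%:R) *+ (k == l)).
    by rewrite -e; apply: eq_bigr => u _; rewrite mulmx_delta_entry !mxE rmorphM.
  rewrite mulr_natr; congr (_ *+ _); rewrite /c -(rmorph_nat j (i == k')) -rmorphM; congr (j _).
  rewrite mulrAC; congr (_ * _); rewrite /mxtrace (bigD1 i) //= mxE eqxx.
  by rewrite big1 ?addr0 // => t nt; rewrite mxE (negPf nt).
have [i [l nzil]] : exists i l, A i l != 0.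
  apply: NNPP => noA; case/eqP: nzA; apply/matrixP => i l; rewrite [RHS]mxE.
  by apply/eqP; apply: contraT => nz; case: noA; exists i, l.
rewrite -sub1mx; apply/row_subP => k; rewrite row1.
have : ((\sum_u map_mx j (s (bdual u)) k l *: (row i A *m map_mx j (s u)))%R <= A)%MS.
  apply: summx_sub => u _; apply: scalemx_sub.
  by apply: submx_trans (invA u); rewrite submxMr ?row_sub.
suff -> : \sum_u map_mx j (s (bdual u)) k l *: (row i A *m map_mx j (s u))
     = (A i l * c) *: delta_mx 0 k.
  by rewrite eqmx_scale // mulf_neq0.
apply/rowP => t; rewrite summxE.
transitivity (\sum_h A i h * \sum_u map_mx j (s u) h t * map_mx j (s (bdual u)) k l).
  under [RHS]eq_bigr do rewrite mulr_sumr.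
  rewrite exchange_big; apply: eq_bigr => u _ /=; rewrite mxE [X in _ * X]mxE mulr_sumr.
  by apply: eq_bigr => h _; rewrite [row i A 0 h]mxE mulrC mulrA.
under eq_bigr do rewrite unitE.
rewrite (bigD1 l) //= eqxx mulr1 big1 ?addr0 => [|h nh].
  by rewrite !mxE eqxx /= mulrA.
by rewrite (negPf nh) !mulr0.
Qed.

Hypothesis allsplit : forall n (s : B -> 'M[E]_n), hmod s -> hsimple s -> hsplit s.

Lemma map_hirr_char f : hirr_char f -> hirr_char [ffun u => j (f u)].
Proof.
move=> [n [s [hs irrs ->]]]; exists n, (fun u => map_mx j (s u)); split.
- exact: map_hmod.
- by apply: map_hsimple => //; apply: allsplit.
by apply/ffunP => u; rewrite !ffunE trace_map_mx.
Qed.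

(** An irreducible character not coming from [E] is orthogonal to those that do, so
    column orthogonality over [E] forces it to vanish on the loops; but its values
    on the identity arrows add up to its degree. *)
Lemma hirr_char_descends g : hirr_char g ->
  exists2 f : {ffun B -> E}, hirr_char f & g = [ffun u => j (f u)].
Proof.
move=> [n [s [hs irrs ->]]]; apply: NNPP => no_f.
have [fs ufs fsP] := hirr_char_finite charE allsplit.
have orth f : f \in fs -> \sum_u hchar s u * j (f (bdual u)) = 0.
  move/fsP => irrf; have [n' [s' [hs' irrs' def_f]]] := map_hirr_char irrf.
  have ne : hchar s != hchar s'.
    by rewrite -def_f; apply/eqP => e; apply: no_f; exists f.
  apply: etrans (hchar_orth hs hs' irrs irrs' ne).
  by apply: eq_bigr => u _; rewrite -def_f [X in _ = _ * X]ffunE.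
have [x_loop x_conj] := hchar_trace_like hs.
have x0 v : bloop v -> hchar s v = 0.
  move=> loopv; have nF0 : #|aT|%:R != 0 :> E'.
    by rewrite -cardsT -(prednK (cardG_gt0 [set: aT]%G)).
  apply: (mulIf nF0); rewrite mul0r mulr_natr.
  transitivity (\sum_u hchar s u * j (\sum_(f <- fs) f (bdual u) * f v)); last first.
    under eq_bigr do rewrite rmorph_sum mulr_sumr.
    rewrite exchange_big big_seq big1 // => f fs_f.
    under eq_bigr do rewrite rmorphM mulrA.
    by rewrite -mulr_suml orth // mul0r.
  transitivity (\sum_u \sum_c hchar s u * (bconj u c == v)%:R); last first.
    apply: eq_bigr => u _; have [loopu|nloopu] := boolP (bloop u); last first.
      by rewrite big1 (x_loop u) ?mul0r // => c _; rewrite mul0r.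
    rewrite (hirr_char_column_orth charE allsplit) // rmorph_sum mulr_sumr.
    by apply: eq_bigr => c _; rewrite rmorph_nat.
  rewrite exchange_big -sumr_const; apply: eq_bigr => c _ /=.
  rewrite (bigD1 (bconj v c^-1%g)) //= bconjKV eqxx mulr1 big1 ?addr0 => [|w nw].
    by rewrite x_conj.
  have [e|_] := eqVneq; last by rewrite mulr0.
  by case/eqP: nw; rewrite -e bconjK.
have [n_gt0 _] := irrs; have := charE' n.-1; rewrite prednK //.
case/eqP; rewrite -mxtrace1 -(proj2 hs) raddf_sum big1 // => x _ /=.
by have := x0 (x, 1%g); rewrite /bloop ffunE /= act1 eqxx => ->.
Qed.

Lemma hirr_char_column_orth_map (gs : seq {ffun B -> E'}) u v :
    uniq gs -> (forall g, g \in gs <-> hirr_char g) -> bloop u ->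
  \sum_(g <- gs) g (bdual u) * g v = \sum_c (bconj u c == v)%:R.
Proof.
move=> ugs gsP loopu; have [fs ufs fsP] := hirr_char_finite charE allsplit.
pose jf (f : {ffun B -> E}) : {ffun B -> E'} := [ffun u => j (f u)].
have perm_gs : perm_eq gs (map jf fs).
  apply: uniq_perm => // [|g].
    rewrite map_inj_uniq // => f1 f2 /ffunP e; apply/ffunP => w.
    by have := e w; rewrite !ffunE => /fmorph_inj.
  apply/idP/mapP => [/gsP/hirr_char_descends[f /fsP fs_f ->] | [f /fsP fs_f ->]].
    by exists f.
  by apply/gsP/map_hirr_char.
rewrite (perm_big _ perm_gs) big_map /=.
transitivity (j (\sum_(f <- fs) f (bdual u) * f v)).
  by rewrite rmorph_sum; apply: eq_bigr => f _; rewrite !ffunE rmorphM.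
rewrite (hirr_char_column_orth charE allsplit) // rmorph_sum.
by apply: eq_bigr => c _; rewrite rmorph_nat.
Qed.

End ExtendScalars.
End Groupoid.

(** * Bismash modules as matrix families *)

Section Bridge.

Variables (gT : finGroupType) (Q F G : {group gT}).
Variable cFG : G \in [complements to F in Q].
Variable E : fieldType.

Local Notation B := (bbasis F G).
Local Notation H := (bismash E cFG).
Local Notation act := (bact cFG).

Lemma bvecM u v : bvec cFG u * bvec cFG v = bvec_mul cFG E u v :> H.
Proof.
rewrite -[LHS]/(bismash_mul _ _) /bismash_mul (bigD1 u) //= (bigD1 v) //=.
rewrite !ffunE !eqxx mulr1 scale1r [X in _ + X + _]big1 ?addr0 => [|w nw].
  rewrite big1 ?addr0 // => w nw; rewrite big1 // => w' _.
  by rewrite !ffunE (negPf nw) mul0r scale0r.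
by rewrite !ffunE (negPf nw) mulr0 scale0r.
Qed.

Lemma bismash_sum (h : H) : h = \sum_u h u *: (bvec cFG u : H).
Proof.
apply/ffunP => v; rewrite sum_ffunE (bigD1 v) //= !ffunE eqxx big1 ?addr0.
  by rewrite -[RHS]/(h v * 1) mulr1.
move=> u nu; rewrite !ffunE eq_sym (negPf nu); exact: mulr0.
Qed.

Definition row_family n (rho : bismash_rep cFG E n) (u : B) : 'M_n.+1 :=
  (rho (bvec cFG u))^T.

Lemma row_family_hmod n (rho : bismash_rep cFG E n) : hmod act (row_family rho).
Proof.
split=> [u v|].
  rewrite /row_family -trmx_mul mulmxE -rmorphM bvecM /bvec_mul.
  by case: ifP => // _; rewrite rmorph0 trmx0.
rewrite /row_family -linear_sum -rmorph_sum -trmx1; congr _^T.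
exact: (rmorph1 rho).
Qed.

Lemma row_familyE n (rho : bismash_rep cFG E n) h :
  rho h = (\sum_u h u *: row_family rho u)^T.
Proof.
rewrite {1}[h]bismash_sum !linear_sum; apply: eq_bigr => u _.
by rewrite !linearZ /= /row_family trmxK.
Qed.

Lemma row_family_simple n (rho : bismash_rep cFG E n) :
  simple_module rho <-> hsimple (row_family rho).
Proof.
split=> [irr | [_ irr] U invU].
  split=> // A invA nzA; pose U : {vspace 'cV[E]_n.+1} := limg (linfun (mulmx A^T)).
  have UP (v : 'cV_n.+1) : v \in U <-> exists w, v = A^T *m w.
    split=> [/memv_imgP[w _ ->] | [w ->]]; first by exists w; rewrite lfunE.
    by rewrite -[A^T *m w](lfunE (mulmx A^T)) memv_img ?memvf.
  have sub_rho h : (A *m (rho h)^T <= A)%MS.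
    rewrite row_familyE trmxK mulmx_sumr summx_sub // => u _.
    by rewrite -scalemxAr scalemx_sub ?invA.
  have [h v /UP[w ->] | U0 | Ufull] := irr U.
  - have /submxP[C defC] := sub_rho h; apply/UP; exists (C^T *m w).
    apply: trmx_inj; rewrite !trmx_mul !trmxK -!mulmxA; congr (_ *m _).
    by rewrite defC.
  - case/eqP: nzA; apply: trmx_inj; rewrite trmx0; apply/matrixP => i l.
    have : A^T *m delta_mx l 0 \in U by apply/UP; exists (delta_mx l 0).
    rewrite U0 memv0 => /eqP/matrixP/(_ i 0); rewrite -colE mxE => ->.
    by rewrite !mxE.
  rewrite -sub1mx; apply/row_subP => i; rewrite row1.
  have /UP[w def_w] : (delta_mx i 0 : 'cV_n.+1) \in U by rewrite Ufull memvf.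
  by rewrite -[delta_mx 0 i]trmxK trmx_delta def_w trmx_mul trmxK submxMl.
pose A : 'M_(\dim U, n.+1) := \matrix_(i < \dim U) ((vbasis U)`_i : 'cV_n.+1)^T.
have AP (v : 'cV_n.+1) : v \in U <-> (v^T <= A)%MS.
  split=> [Uv | /submxP[c def_v]].
    rewrite (coord_vbasis Uv) linear_sum /= summx_sub // => i _.
    rewrite linearZ scalemx_sub //=; apply: (eq_row_sub i).
    by rewrite rowK.
  rewrite -[v]trmxK def_v mulmx_sum_row linear_sum /= memv_suml // => i _.
  rewrite linearZ /= memvZ // rowK trmxK.
  by apply: vbasis_mem; rewrite mem_nth // size_tuple.
have [A0|nzA] := eqVneq A 0.
  left; apply/eqP; rewrite -subv0; apply/subvP => v /AP.
  case/submxP=> c; rewrite A0 mulmx0 memv0 => /(congr1 trmx).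
  by rewrite trmxK trmx0 => ->.
have bU (i : 'I_(\dim U)) : (vbasis U)`_i \in U.
  by apply: vbasis_mem; rewrite mem_nth // size_tuple.
have invA : hinv (row_family rho) <<A>>%MS.
  move=> u; rewrite (eqmxMr _ (genmxE A)) genmxE; apply/row_subP => i.
  by rewrite row_mul rowK -trmx_mul; apply/AP/invU.
have : row_full <<A>>%MS by apply: irr; rewrite // (eqmx_eq0 (genmxE A)).
rewrite /row_full (genmxE A) => fullA.
right; apply/eqP; rewrite eqEsubv subvf; apply/subvP => v _; apply/AP.
exact: submx_full.
Qed.

Section OfFamily.

Variables (n : nat) (s : B -> 'M[E]_n.+1).
Hypothesis hs : hmod act s.

Definition family_rep (h : H) : 'M[E]_n.+1 := (\sum_u h u *: s u)^T.

Lemma family_rep_zmod : zmod_morphism family_rep.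
Proof.
move=> f g; rewrite /family_rep -linearB -sumrB; congr _^T; apply: eq_bigr => u _.
by rewrite !ffunE scalerBl.
Qed.

Lemma family_rep_scale : scalable family_rep.
Proof.
move=> a f; rewrite /family_rep -linearZ scaler_sumr; congr _^T.
by apply: eq_bigr => u _; rewrite ffunE scalerA.
Qed.

Lemma family_rep_bvec u : family_rep (bvec cFG u) = (s u)^T.
Proof.
rewrite /family_rep (bigD1 u) //= ffunE eqxx scale1r big1 ?addr0 // => v nv.
by rewrite ffunE (negPf nv) scale0r.
Qed.

HB.instance Definition _ := GRing.isZmodMorphism.Build H _ family_rep family_rep_zmod.
HB.instance Definition _ := GRing.isScalable.Build E H _ _ family_rep family_rep_scale.

Lemma family_rep_monoid : monoid_morphism family_rep.
Proof.
split=> [|f g].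
  rewrite -[1 in LHS]/(bismash_one cFG E) /bismash_one linear_sum /=.
  under eq_bigr do rewrite family_rep_bvec.
  by rewrite -linear_sum /= (proj2 hs) trmx1.
rewrite [f in LHS]bismash_sum [g in LHS]bismash_sum mulr_suml linear_sum /=.
rewrite [f in RHS]bismash_sum linear_sum mulr_suml; apply: eq_bigr => u _ /=.
rewrite mulr_sumr linear_sum [g in RHS]bismash_sum linear_sum mulr_sumr /=.
apply: eq_bigr => v _; rewrite -scalerAl -scalerAr !linearZ /= -scalerAl -scalerAr.
do 2!congr (_ *: _); rewrite bvecM /bvec_mul !family_rep_bvec -mulmxE -trmx_mul.
rewrite (proj1 hs); case: ifP => _; first exact: family_rep_bvec.
by rewrite trmx0 linear0.
Qed.

HB.instance Definition _ := GRing.isMonoidMorphism.Build H _ family_rep family_rep_monoid.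

Definition rep_of_family : bismash_rep cFG E n := family_rep.

Lemma row_family_rep : row_family rep_of_family =1 s.
Proof. by move=> u; rewrite /row_family /= family_rep_bvec trmxK. Qed.

End OfFamily.

Lemma hsimple_ext n (s1 s2 : B -> 'M[E]_n) : s1 =1 s2 -> hsimple s1 -> hsimple s2.
Proof.
move=> e [n_gt0 irr]; split=> // A invA; apply: irr => u; rewrite e; exact: invA.
Qed.

Lemma irr_characterE (f : {ffun B -> E}) :
  irr_character cFG f <-> hirr_char act f.
Proof.
split=> [[n [rho [/row_family_simple irr ->]]] | [n [s [hs irrs ->]]]].
  exists n.+1, (row_family rho); split=> //; first exact: row_family_hmod.
  by apply/ffunP => u; rewrite !ffunE mxtrace_tr.
case: n s hs irrs => [|n] s hs irrs; first by case: irrs.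
exists n, (rep_of_family hs); split.
  by apply/row_family_simple; apply: hsimple_ext irrs => u; rewrite row_family_rep.
by apply/ffunP => u; rewrite !ffunE -(row_family_rep hs) mxtrace_tr.
Qed.

Lemma splitting_field_hsplit : splitting_field cFG E ->
  forall n (s : B -> 'M[E]_n), hmod act s -> hsimple s -> hsplit s.
Proof.
move=> splitE [|n] s hs irrs A commA; first by case: irrs.
have irr : simple_module (rep_of_family hs).
  by apply/row_family_simple; apply: hsimple_ext irrs => u; rewrite row_family_rep.
have /is_scalar_mxP[a defA] : is_scalar_mx A^T.
  apply: splitE irr _ _ => h; rewrite row_familyE -!trmx_mul; congr _^T.
  rewrite mulmx_suml mulmx_sumr; apply: eq_bigr => u _.
  by rewrite -scalemxAl -scalemxAr row_family_rep commA.
by apply/is_scalar_mxP; exists a; rewrite -[A]trmxK defA tr_scalar_mx.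
Qed.

End Bridge.

(** * Determinants of integral matrices *)

Section GramDeterminant.

Import Order.TTheory Num.Theory.

(** The determinant is a product of eigenvalues of a Hermitian matrix over the
    algebraic numbers, and each of them is a sum of squared norms. *)
Lemma det_gram_ge0 (n d : nat) (D : 'M[int]_(n, d)) : 0 <= \det (D^T *m D).
Proof.
pose Dc : 'M[algC]_(n, d) := map_mx intr D; pose A := Dc^T *m Dc.
have detA : \det A = (\det (D^T *m D))%:~R.
  by rewrite -det_map_mx map_mxM /A /Dc map_trmx.
rewrite -(ler_int algC) -detA.
have realD : map_mx Num.conj Dc = Dc.
  by apply/matrixP => i j; rewrite !mxE rmorph_int.
have hermA : A \is hermsymmx.
  apply/is_hermitianmxP; rewrite expr0 scale1r trmx_mul trmxK map_mxM.
  by rewrite -map_trmx realD.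
have /orthomx_spectralP := hermitian_normalmx hermA.
set P := spectralmx A; set sp := spectral_diag A => defA.
have uP : P \in unitmx := spectral_unit A.
have invP : invmx P = map_mx Num.conj P^T by rewrite invmx_unitary ?spectral_unitarymx.
rewrite defA !det_mulmx mulrAC -det_mulmx mulVmx // det1 mul1r det_diag.
apply: prodr_ge0 => i _.
have <- : (P *m A *m invmx P) i i = sp 0 i.
  by rewrite defA !mulmxA mulmxV // mul1mx mulmxK // mxE eqxx.
pose B := P *m Dc^T.
have -> : P *m A *m invmx P = B *m map_mx Num.conj B^T.
  by rewrite invP /A /B trmx_mul trmxK map_mxM realD !mulmxA.
by rewrite mxE sumr_ge0 // => k _; rewrite !mxE mul_conjC_ge0.
Qed.

End GramDeterminant.

Section PrimeDivisors.

Variable R : idomainType.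
Hypothesis charR : forall n, n.+1%:R != 0 :> R.

Local Notation integral := (integralOver (intr : int -> R)).

Lemma intr_inj_char0 : injective (intr : int -> R).
Proof.
move=> x y /eqP; rewrite -subr_eq0 -rmorphB /= => e; apply/eqP; rewrite -subr_eq0.
apply: contraT; case: (x - y) e => [[|n]|n] //=; first by rewrite (negPf (charR n)).
by rewrite NegzE rmorphN oppr_eq0 /= (negPf (charR n)).
Qed.

(** A rational prime is not a unit among the algebraic integers: multiply a monic
    equation for the inverse by a power of [q] and reduce it modulo [q]. *)
Lemma prime_not_integral_unit q (y : R) : prime q -> integral y -> q%:R * y <> 1.
Proof.
move=> q_pr [P monP rootP] qy1.
have [n szP] : exists n, size P = n.+1.
  by exists (size P).-1; rewrite prednK // lt0n size_poly_eq0 monic_neq0.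
pose S : int := \sum_(i < n.+1) P`_i * q%:Z ^+ (n - i).
have S0 : S = 0.
  apply: intr_inj_char0; rewrite rmorph_sum /=.
  have := rootP; rewrite /root horner_coef size_map_inj_poly ?szP //; last exact: intr_inj_char0.
  move/eqP/(congr1 (fun x => q%:R ^+ n * x)); rewrite mulr0 mulr_sumr => e.
  apply: etrans e; apply: eq_bigr => i _.
  rewrite coef_map /= rmorphM rmorphXn /= mulrCA; congr (_ * _).
  have le_in : (i <= n)%N by rewrite -ltnS.
  have -> : q%:R ^+ n = q%:R ^+ (n - i) * q%:R ^+ i :> R by rewrite -exprD subnK.
  rewrite -mulrA -exprMn qy1 expr1n mulr1.
  by [].
have : (- 1)%R \in dvdz q%:Z.
  have := monP; rewrite monicE lead_coefE szP /= => /eqP Pn.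
  move: S0; rewrite /S big_ord_recr /= subnn expr0 mulr1 Pn => /eqP.
  rewrite addr_eq0 => /eqP <-; apply: rpred_sum => i _; apply: dvdz_mull.
  by rewrite -(subnSK (ltn_ord i)) exprS; apply: dvdz_mulr.
by rewrite dvdzE /= Euclid_dvd1.
Qed.

Lemma det_integral n (A : 'M[R]_n) : (forall i j, integral (A i j)) -> integral (\det A).
Proof.
move=> intA; apply: integral_sum => s _; apply: integral_mul.
  by case: (odd_perm s); rewrite ?expr0 ?expr1; [apply: integral_opp|]; apply: integral1.
by apply: (big_ind integral) => // [|*]; [apply: integral1 | apply: integral_mul].
Qed.

(** If [M *m C] is the scalar [N] and the entries of [M] are multiples of the full
    [q]-part of [N], then dividing by this part shows that [\det C] divides a power
    of the prime-to-[q] part of [N]. *)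
Lemma det_prime_power d p N (C : 'M[int]_d) (M : 'M[R]_d) :
    prime p -> (0 < N)%N -> 0 <= \det C ->
    M *m map_mx intr C = N%:R%:M ->
    (forall q i j, prime q -> q != p -> int_dvd (N`_q) (M i j)) ->
  exists e, \det C = (p ^ e)%:Z.
Proof.
move=> p_pr N_gt0 detC_ge0 MC M_dvd.
have nzN k : (0 < k)%N -> k%:R != 0 :> R by move/prednK <-.
have detC_natE : \det C = `|\det C|%N%:Z by rewrite gez0_abs.
have detC_neq0 : \det C != 0.
  apply: contraTneq (nzN N N_gt0) => detC0; have := congr1 determinant MC.
  rewrite det_mulmx det_map_mx detC0 rmorph0 mulr0 det_scalar => /esym/eqP.
  by rewrite expf_eq0 => /andP[_ /eqP->]; rewrite eqxx.
suff /p_natP[e def_e] : p.-nat `|\det C|%N by exists e; rewrite detC_natE def_e.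
rewrite /pnat absz_gt0 detC_neq0; apply/allP => q; rewrite mem_primes.
case/and3P=> q_pr _ q_dv; rewrite inE /=; apply: contraT => nqp.
have [M' M'P] : exists M' : 'I_d * 'I_d -> R, forall ij, integral (M' ij) /\
    M ij.1 ij.2 = M' ij *+ (N`_q)%N.
  apply: (fin_all_exists (P := fun ij y => integral y /\ M ij.1 ij.2 = y *+ (N`_q)%N)).
  by move=> [i j]; have [y iy Mij] := M_dvd q i j q_pr nqp; exists y.
pose E := \matrix_(i, j) M' (i, j).
have def_M : M = (N`_q)%:R *: E.
  by apply/matrixP => i j; rewrite !mxE mulr_natl; have [] := M'P (i, j).
have EC : E *m map_mx intr C = (N`_q^')%:R%:M.
  have nzq := nzN _ (part_gt0 q N).
  have e : (N`_q)%:R *: (E *m map_mx intr C) = (N`_q)%:R *: (N`_q^')%:R%:M.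
    by rewrite scalemxAl -def_M MC scale_scalar_mx -natrM partnC.
  by apply/matrixP => i j; move/matrixP/(_ i j): e; rewrite mxE [RHS]mxE => /(mulfI nzq).
have intE : integral (\det E).
  by apply: det_integral => i j; rewrite mxE; have [] := M'P (i, j).
have := congr1 determinant EC; rewrite det_mulmx det_map_mx det_scalar -natrX => detEC.
have [c def_c] := dvdnP q_dv.
set K := (N`_q^' ^ d)%N in detEC.
have cop : coprime q K.
  rewrite coprimeXr // prime_coprime //; apply/negP => q_dvK.
  by have := part_pnat q^' N; rewrite p'natE // q_dvK.
have [a _] := Bezoutr K (prime_gt0 q_pr).
rewrite gcdnC (eqP cop) => /dvdnP[b def_b].
have int_y : integral (b%:R - a%:R * (c%:R * \det E)).
  have intn k : integral k%:R by apply: integral_nat.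
  by apply: integral_sub => //; apply: integral_mul => //; apply: integral_mul.
case: (prime_not_integral_unit q_pr int_y).
have e1 : (b * q)%:R - a%:R * K%:R = 1 :> R by rewrite -def_b natrD natrM addrK.
apply: etrans e1; rewrite mulrBr; congr (_ - _); first by rewrite natrM mulrC.
rewrite -detEC detC_natE def_c /= mulrCA; congr (_ * _).
by rewrite -pmulrn natrM [RHS]mulrC -mulrA mulrCA.
Qed.

End PrimeDivisors.

(** * Representations of stabilisers *)

Section Transport.

Variables (aT : finGroupType) (rT : finType) (act : {action aT &-> rT}).
Variables (E : fieldType) (x y : rT) (c : aT).
Hypothesis yc : act y c = x.
Variables (n : nat) (rW : mx_representation E 'C[x | act] n).

Lemma stab_conj a : (a ^ c \in 'C[x | act])%g = (a \in 'C[y | act]).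
Proof. by rewrite -yc astab1_act memJ_conjg. Qed.

Lemma transport_mx_repr : mx_repr 'C[y | act] (fun a => rW (a ^ c)%g).
Proof.
split=> [|a b Ca Cb]; first by rewrite conj1g repr_mx1.
by rewrite conjMg repr_mxM // stab_conj.
Qed.

Definition transport_repr := MxRepresentation transport_mx_repr.

Lemma transport_irr : mx_irreducible rW -> mx_irreducible transport_repr.
Proof.
case/mx_irrP=> n_gt0 irrW; apply/mx_irrP; split=> // U modU; apply: irrW.
apply/mxmoduleP => b Cb.
have Ca : (b ^ c^-1)%g \in 'C[y | act] by rewrite -stab_conj conjgKV.
by have := mxmoduleP modU _ Ca; rewrite /= conjgKV.
Qed.

End Transport.

(** Two transporters differ by an element of the stabiliser of [x]. *)
Lemma brtr_transport (aT : finGroupType) (rT : finType) (act : {action aT &-> rT})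
    (R : idomainType) (E : fieldType) (red : {rmorphism R -> E}) m z x y c1 c2 a n
    (rW : mx_representation E 'C[x | act] n) :
    act y c1 = x -> act y c2 = x -> a \in 'C[y | act] ->
  brtr red m z (rW (a ^ c1)%g) = brtr red m z (rW (a ^ c2)%g).
Proof.
move=> yc1 yc2 Ca; pose h := (c1^-1 * c2)%g.
have Ch : h \in 'C[x | act] by apply/astab1P; rewrite -{1}yc1 -actM mulKVg.
have -> : (a ^ c2 = (a ^ c1) ^ h)%g by rewrite -conjgM mulKVg.
have Cb : (a ^ c1)%g \in 'C[x | act] by rewrite (stab_conj yc1).
move: (a ^ c1)%g Cb => b Cb.
have -> : rW (b ^ h)%g = invmx (rW h) *m rW b *m rW h.
  have e : (b ^ h)%g = (h^-1 * b * h)%g by rewrite conjgE mulgA.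
  rewrite e.
  rewrite (repr_mxM rW (groupM (groupVr Ch) Cb) Ch).
  rewrite (repr_mxM rW (groupVr Ch) Cb).
  by rewrite repr_mxV.
by rewrite /brtr char_poly_conj ?repr_mx_unit.
Qed.

Section HatCharacter.

Variables (gT : finGroupType) (Q F G : {group gT}).
Variable cFG : G \in [complements to F in Q].
Variables (p : nat) (R : idomainType) (k : fieldType) (red : {rmorphism R -> k}).
Variable z : R.

Local Notation act := (bact cFG).
Local Notation m := (#|F|`_p^')%N.
Hypotheses (prim_z : m.-primitive_root z) (mk : m%:R != 0 :> k).

Lemma hat_char_off x (phi : [subg F] -> {fraction R}) u :
  (forall c, act u.1 c <> x) -> hat_char cFG x phi u = 0.
Proof.
move=> Nx; rewrite /hat_char big1 // => t _.
by case: eqP => [/Nx//|_]; rewrite mul0r.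
Qed.

(** All transporters from [u.1] to [x] lie in one coset of the stabiliser of [x], so
    exactly one coset representative contributes. *)
Lemma hat_char_on x (phi : [subg F] -> {fraction R}) u c :
    act u.1 c = x -> u.2 \in 'C[u.1 | act] ->
  exists t, act u.1 t = x /\ hat_char cFG x phi u = phi (u.2 ^ t)%g.
Proof.
case: u => y a; change ((y, a).1) with y; change ((y, a).2) with a => yc Ca.
pose t := repr (c *: 'C[x | act])%g.
have /lcosetP[h Ch def_t] : t \in (c *: 'C[x | act])%g.
  exact: mem_repr (lcoset_refl _ _).
have yt : act y t = x by rewrite def_t actM yc; apply/astab1P.
have repsP t' : t' \in stab_reps cFG x -> act y t' = x -> t' = t.
  case/imsetP=> _ /lcosetsP[b _ ->] def_t' yt'.
  have t'b : t' \in (b *: 'C[x | act])%g.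
    rewrite def_t'; exact: mem_repr (lcoset_refl _ _).
  rewrite def_t' /t; congr repr; rewrite -(lcoset_eqP t'b).
  apply/lcoset_eqP; rewrite mem_lcoset; apply/astab1P.
  by rewrite actM -{1}yc actK.
exists t; split=> //; rewrite /hat_char (bigD1 t); last first.
  change ((y, a).2) with a.
  rewrite (stab_conj yt) Ca andbT; apply/imsetP; exists (c *: 'C[x | act])%g => //.
  by apply/lcosetsP; exists c.
change ((y, a).1) with y; rewrite yt eqxx mul1r big1; first exact: addr0.
move=> t' /andP[/andP[Tt' _] nt'].
change ((y, a).1) with y.
by case: eqP => [/(repsP t' Tt') e|_]; [rewrite e eqxx in nt' | rewrite mul0r].
Qed.

Lemma is_brauer_charE (J : {group [subg F]}) n (rW : mx_representation k J n) phi g :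
    is_brauer_char p red rW phi -> g \in J -> p^'.-elt g ->
  phi g = tofrac (brtr red m z (rW g)).
Proof.
move=> brW Jg p'g; have [s [s1 def_p ->]] := brW g Jg p'g.
by rewrite (brtr_lifts mk prim_z s1 def_p) rmorph_sum.
Qed.

(** The Brauer character of the induced module, with values in [R].  It is defined
    on the whole basis; the choice of the transporter is immaterial on the loops by
    [brtr_transport]. *)
Definition brval x n (rW : mx_representation k 'C[x | act] n) (u : bbasis F G) : R :=
  if [pick c | act u.1 c == x] is Some c then brtr red m z (rW (u.2 ^ c)%g) else 0.

Lemma brval_off x n (rW : mx_representation k 'C[x | act] n) u :
  (forall c, act u.1 c <> x) -> brval rW u = 0.
Proof. by rewrite /brval; case: pickP => // c /eqP yc Nx; case: (Nx c). Qed.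

Lemma brval_on x n (rW : mx_representation k 'C[x | act] n) u c :
    act u.1 c = x -> u.2 \in 'C[u.1 | act] ->
  brval rW u = brtr red m z (rW (u.2 ^ c)%g).
Proof.
rewrite /brval; case: pickP => [c' /eqP yc' yc Ca | N yc]; last by have := N c; rewrite yc eqxx.
exact: brtr_transport yc' yc Ca.
Qed.

Lemma brval_conj x n (rW : mx_representation k 'C[x | act] n) u c :
  u.2 \in 'C[u.1 | act] -> brval rW (bconj act u c) = brval rW u.
Proof.
move=> Cu; have Cuc : (bconj act u c).2 \in 'C[(bconj act u c).1 | act].
  exact: etrans (stab_conj (erefl (act u.1 c)) u.2) Cu.
have [[c' uc'] | Nx] := classic (exists c', act u.1 c' = x).
  have uc : act (act u.1 c) (c^-1 * c')%g = x by rewrite -actM mulKVg.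
  rewrite (brval_on rW uc' Cu) (brval_on rW (u := bconj act u c) uc Cuc).
  by rewrite [(bconj act u c).2]/(u.2 ^ c)%g -conjgM mulKVg.
rewrite !brval_off // => c' uc'; apply: Nx; first by exists c'.
by exists (c * c')%g; apply: etrans (actM act u.1 c c') uc'.
Qed.

Definition stab_repr :=
  {x : [subg G] & {n : nat & mx_representation k 'C[x | act] n}}.

Lemma irr_brauer_character_brval f : irr_brauer_character cFG red f ->
  exists V : stab_repr, mx_irreducible (tagged (tagged V)) /\
    forall u : breg cFG p, f u = tofrac (brval (tagged (tagged V)) (val u)).
Proof.
move=> [_ [_ [_ [x [n [rW [phi [irrW _ brW ->]]]]]]]].
exists (existT _ x (existT _ n rW)); split=> // u; rewrite ffunE; have /andP[Cu p'u] := valP u.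
have [[c uc] | Nx] := classic (exists c, act (val u).1 c = x); last first.
  by rewrite hat_char_off ?brval_off ?rmorph0 // => c uc; apply: Nx; exists c.
have [t [ut ->]] := hat_char_on phi uc Cu.
rewrite (brval_on rW ut Cu) (is_brauer_charE brW) ?p_eltJ //.
by rewrite (stab_conj ut).
Qed.

End HatCharacter.

(** * The p-modular system *)

Section ModularSystem.

Variables (p : nat) (L : fieldExtType rat) (P : L -> Prop).
Hypotheses (p_prime : prime p) (P_prime : prime_ideal P) (P_over_p : P p%:R).
Variables (R : idomainType) (j : {rmorphism L -> {fraction R}}) (pi : R).
Hypothesis R_completion : is_completion P j pi.
Variables (k : fieldType) (red : {rmorphism R -> k}).
Hypothesis k_residue : is_residue_map pi red.

Lemma number_field_char0 n : n.+1%:R != 0 :> L.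
Proof.
have -> : n.+1%:R = n.+1%:R%:A :> L by rewrite scaler_nat.
by rewrite scaler_eq0 oner_eq0 orbF Num.Theory.pnatr_eq0.
Qed.

Lemma completion_frac_char0 n : n.+1%:R != 0 :> {fraction R}.
Proof. by rewrite -(rmorph_nat j) fmorph_eq0 number_field_char0. Qed.

Lemma completion_char0 n : n.+1%:R != 0 :> R.
Proof.
have := completion_frac_char0 n; rewrite -(rmorph_nat (@tofrac R)).
by rewrite tofrac_eq0.
Qed.

Lemma P_integer_nat n : P_integer P n%:R.
Proof.
exists n%:R, 1; split; rewrite ?divr1 //; first exact: integral_nat.
  exact: integral1.
exact: prime_ideal_proper P_prime.
Qed.

Lemma uniformizer_dvd_p : rdivides pi p%:R.
Proof.
have jp : j p%:R = tofrac p%:R by rewrite !rmorph_nat.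
have [to_pi _] := compl_induced R_completion 1 (P_integer_nat p) jp.
rewrite -[pi]expr1; apply: to_pi; exists [:: (p%:R, 1)]; split=> [u|].
  rewrite inE => /eqP-> /=; split; last exact: (P_integer_nat 1).
  exists p%:R, 1; split=> //; rewrite ?divr1 //; first exact: integral1.
  exact: prime_ideal_proper P_prime.
by rewrite big_seq1 mulr1.
Qed.

Lemma residue_pchar : p \in [pchar k].
Proof.
rewrite inE p_prime -(rmorph_nat red); apply/eqP.
exact/(proj2 k_residue)/uniformizer_dvd_p.
Qed.

Lemma residue_p'nat_neq0 n : (p^'.-nat n)%N -> n%:R != 0 :> k.
Proof. by move=> p'n; rewrite -(dvdn_pcharf residue_pchar) -p'natE. Qed.

(** As long as all coefficients reduce to 0 they can be divided by [pi]; this stops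
    because no nonzero element is divisible by all powers of [pi]. *)
Lemma residue_unimodular : has_unimodular_multiples red.
Proof.
move=> l a [i0 nzai].
have nz_pi : pi != 0.
  apply/eqP=> pi0; have [q def_p] := uniformizer_dvd_p.
  have := completion_char0 p.-1; rewrite prednK ?prime_gt0 //.
  by rewrite def_p pi0 mulr0 eqxx.
have [N Ndv] : exists N, ~ rdivides (pi ^+ N) (a i0).
  apply: NNPP => dv; case/eqP: nzai; apply: (compl_separated R_completion) => N.
  by apply: NNPP => Ndv; apply: dv; exists N.
elim: N => [|N IHN] in a nzai Ndv *; first by case: Ndv; exists (a i0); rewrite mulr1.
have [[i nzi]|all0] := classic (exists i, red (a i) <> 0).
  by exists 1, a; split; [exact: oner_neq0 | move=> ?; rewrite mul1r | exists i; apply/eqP].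
have [b def_a] : exists b : 'I_l -> R, forall i, a i = b i * pi.
  apply: (fin_all_exists (P := fun i y => a i = y * pi)) => i.
  have /(proj2 k_residue)[q def_q] : red (a i) = 0.
    by apply: NNPP => nz; apply: all0; exists i.
  by exists q.
have [||c [b' [nzc def_b [i nzi]]]] := IHN b.
- by apply: contra nzai => /eqP b0; rewrite def_a b0 mul0r.
- by case=> q def_q; apply: Ndv; exists q; rewrite def_a def_q exprSr mulrA.
exists (c * pi), b'; split; [by rewrite mulf_neq0 | | by exists i].
by move=> i'; rewrite def_a def_b mulrAC.
Qed.

End ModularSystem.

(** * Brauer characters of the bismash product *)

Section BrauerRows.

Variables (gT : finGroupType) (Q F G : {group gT}).
Variable cFG : G \in [complements to F in Q].
Variables (p : nat) (R : idomainType) (k : fieldType) (red : {rmorphism R -> k}).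
Variable z : R.

Local Notation act := (bact cFG).
Local Notation m := (#|F|`_p^')%N.
Hypotheses (prim_z : m.-primitive_root z) (mk : m%:R != 0 :> k).
Hypotheses (p_prime : prime p) (pk : p \in [pchar k]).

Lemma subg_card : #|[set: [subg F]]| = #|F|.
Proof. by rewrite cardsT card_sub. Qed.

Lemma stab_p'part (x : [subg G]) : (#|'C[x | act]|`_p^' %| m)%N.
Proof. by rewrite partn_dvd ?cardG_gt0 // -subg_card cardSg ?subsetT. Qed.

Lemma brval_transport_repr x y c n (rW : mx_representation k 'C[x | act] n) a
    (yc : act y c = x) : a \in 'C[y | act] ->
  brtr red m z (transport_repr yc rW a) = brval p red z rW (y, a).
Proof. by move=> Ca; rewrite (brval_on p red z rW (u := (y, a)) yc Ca). Qed.

(** Linear independence is a statement about one orbit at a time, where it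
    becomes the linear independence of Brauer characters of a stabiliser. *)
Lemma brval_free d (X : 'I_d -> [subg G]) (nn : 'I_d -> nat)
    (rW : forall l, mx_representation k 'C[X l | act] (nn l)) (a : 'I_d -> R) :
    (forall n, n.+1%:R != 0 :> R) -> has_unimodular_multiples red ->
    (forall l, mx_irreducible (rW l)) ->
    (forall l1 l2, (forall u, preg_basis cFG p u ->
       brval p red z (rW l1) u = brval p red z (rW l2) u) -> l1 = l2) ->
    (forall u, preg_basis cFG p u -> \sum_l a l * brval p red z (rW l) u = 0) ->
  forall l, a l = 0.
Proof.
move=> charR redR irrW injW sum0 l0; pose x := X l0.
pose I := [set l | [exists c, act x c == X l]].
have IP l : reflect (exists c, act x c = X l) (l \in I).
  by rewrite inE; apply: (iffP existsP) => -[c /eqP]; exists c => //; apply/eqP.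
have IK (i : 'I_#|I|) : exists V : {n : nat & mx_representation k 'C[x | act] n},
    mx_irreducible (tagged V) /\ forall b, b \in 'C[x | act] ->
      brtr red m z (tagged V b) = brval p red z (rW (enum_val i)) (x, b).
  have /IP[c xc] := enum_valP i.
  exists (Tagged (mx_representation k 'C[x | act]) (transport_repr xc (rW (enum_val i)))).
  by split=> [|b Cb]; [apply: transport_irr | apply: brval_transport_repr].
have {IK}[W W_P] := fin_all_exists IK.
have p'C b : b \in 'C[x | act] -> b.`_p^' \in 'C[x | act] by apply: groupX.
have pregC b : b \in 'C[x | act] -> preg_basis cFG p (x, b.`_p^').
  by move=> Cb; rewrite /preg_basis /= p'C //= p_elt_constt.
have brW i b : b \in 'C[x | act] ->
    brchar m z p red (W i) b = brval p red z (rW (enum_val i)) (x, b.`_p^').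
  by move=> Cb; rewrite ffunE Cb; have [_ ->] := W_P i; rewrite ?p'C.
have aI (i : 'I_#|I|) : a (enum_val i) = 0.
  apply: (brchar_free (W := W) (a := fun i => a (enum_val i)) prim_z
     (stab_p'part x) mk pk charR redR _ _ _ i).
  - by move=> i'; have [] := W_P i'.
  - move=> i1 i2 /ffunP e; apply: enum_val_inj; apply: injW => u /andP[Cu p'u].
    have [[c uc] | Nx] := classic (exists c, act u.1 c = x); last first.
      have offI (i' : 'I_#|I|) : brval p red z (rW (enum_val i')) u = 0.
        apply: brval_off => c uc; have /IP[c' xc'] := enum_valP i'.
        by apply: Nx; exists (c * c'^-1)%g; rewrite actM uc -xc' actK.
      by rewrite !offI.
    have Cuc : (u.2 ^ c)%g \in 'C[x | act] by rewrite (stab_conj uc).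
    have p'uc : (u.2 ^ c)%g.`_p^' = (u.2 ^ c)%g by apply: constt_p_elt; rewrite p_eltJ.
    have := e (u.2 ^ c)%g; rewrite !brW // p'uc.
    have <- : bconj act u c = (x, (u.2 ^ c)%g) by rewrite /bconj uc.
    by rewrite !brval_conj.
  move=> b Cb; apply: etrans (sum0 _ (pregC b Cb)).
  rewrite [RHS](bigID [in I]) /= [X in _ + X]big1 ?addr0 => [|l NIl]; last first.
    rewrite (brval_off p red z (rW l)) ?mulr0 // => c xc.
    by case/IP: NIl; exists c.
  rewrite [RHS]big_enum_val /=; apply: eq_bigr => i' _.
  by rewrite brW.
have Il0 : l0 \in I by apply/IP; exists 1%g; apply: act1.
by rewrite -(enum_rankK_in Il0 Il0).
Qed.

Lemma preg_loop u : preg_basis cFG p u -> bloop act u.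
Proof. by case/andP=> /astab1P e _; apply/eqP. Qed.

Lemma preg_dual u : preg_basis cFG p u -> bdual act u = (u.1, u.2^-1)%g.
Proof. by case/andP=> /astab1P e _; rewrite /bdual e. Qed.

(** The sum is taken over the points [y] first.  The inner sum, over the stabiliser
    of [y], is a sum of products of two Brauer characters of that stabiliser and is
    constant on orbits, so [int_dvd_orbit_sum] applies. *)
Lemma int_dvd_brval_product q x1 n1 (rW1 : mx_representation k 'C[x1 | act] n1)
    x2 n2 (rW2 : mx_representation k 'C[x2 | act] n2) :
    prime q -> p != q ->
  int_dvd (#|F|`_q) (\sum_(u | preg_basis cFG p u)
     brval p red z rW1 u * brval p red z rW2 (bdual act u)).
Proof.
move=> q_pr neq_pq; rewrite -subg_card.
pose w y := \sum_(a in 'C[y | act] | p^'.-elt a)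
  brval p red z rW1 (y, a) * brval p red z rW2 (y, a^-1)%g.
have -> : \sum_(u | preg_basis cFG p u) brval p red z rW1 u * brval p red z rW2 (bdual act u)
    = \sum_(y in [set: [subg G]]) w y.
  rewrite [RHS](eq_bigl xpredT) => [|y]; last by rewrite inE.
  rewrite pair_big_dep /=; apply: eq_big => u //.
  by move=> pu; rewrite (preg_dual pu); case: u pu.
apply: (int_dvd_orbit_sum (to := act) (J := [set: [subg F]]%G)) => [|y c _ _|y _].
- by apply/actsP=> c _ y; rewrite !inE.
- rewrite /w (reindex_inj (conjg_inj c)) /=.
  apply: eq_big => [a|a /andP[Ca _]].
    by rewrite p_eltJ; congr (_ && _); exact: (stab_conj (erefl (act y c)) a).
  have {}Ca : a \in 'C[y | act] by exact: etrans (esym (stab_conj (erefl (act y c)) a)) Ca.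
  have e b : (act y c, b ^ c)%g = bconj act (y, b) c by [].
  by rewrite -conjVg !e !brval_conj ?groupV.
have -> : 'C_[set: [subg F]][y | act] = 'C[y | act] by apply/setIidPr/subsetT.
have [[c1 yc1] | N1] := classic (exists c, act y c = x1); last first.
  rewrite /w big1; first exact: int_dvd0.
  by move=> a _; rewrite brval_off ?mul0r // => c yc; apply: N1; exists c.
have [[c2 yc2] | N2] := classic (exists c, act y c = x2); last first.
  rewrite /w big1; first exact: int_dvd0.
  by move=> a _; rewrite (brval_off p red z rW2) ?mulr0 // => c yc; apply: N2; exists c.
rewrite /w (eq_bigr (fun a => brtr red m z (transport_repr yc1 rW1 a) *
                              brtr red m z (transport_repr yc2 rW2 a^-1%g))).
  exact: (int_dvd_brtr_product red prim_z mk q_pr neq_pq _ _ p_prime (stab_p'part y)).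
by move=> a /andP[Ca _]; rewrite !brval_transport_repr ?groupV.
Qed.

End BrauerRows.

(** * The Cartan matrix *)

Section ConjugationSum.

Variables (gT : finGroupType) (Q F G : {group gT}).
Variable cFG : G \in [complements to F in Q].
Variables (p : nat) (R : idomainType) (k : fieldType) (red : {rmorphism R -> k}).
Variable z : R.

Local Notation act := (bact cFG).

Lemma preg_basis_conj u c : preg_basis cFG p (bconj act u c) = preg_basis cFG p u.
Proof.
by rewrite /preg_basis p_eltJ; congr (_ && _); apply: (stab_conj (erefl (act u.1 c))).
Qed.

Lemma preg_basis_dual u : preg_basis cFG p u -> preg_basis cFG p (bdual act u).
Proof.
by move=> pu; rewrite (preg_dual pu) /preg_basis groupV p_eltV; case/andP: pu => -> ->.
Qed.

Lemma brval_conj_sum x n (rW : mx_representation k 'C[x | act] n) v :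
    preg_basis cFG p v ->
  \sum_(u | preg_basis cFG p u) brval p red z rW u * (\sum_c (bconj act u c == v)%:R)
    = #|F|%:R * brval p red z rW v.
Proof.
move=> pv; under eq_bigr do rewrite mulr_sumr.
rewrite exchange_big /= -(subg_card F) cardsT mulr_natl -sumr_const.
apply: eq_bigr => c _; have vc : bconj act (bconj act v c^-1) c = v by apply: bconjKV.
rewrite (bigD1 (bconj act v c^-1)) ?preg_basis_conj //= vc eqxx mulr1.
rewrite brval_conj; last by case/andP: pv.
rewrite big1 ?addr0 // => u /andP[_ nu]; case: eqP => [e|_]; last by rewrite mulr0.
by case/eqP: nu; rewrite -e bconjK.
Qed.

End ConjugationSum.

Theorem theorem4p14
  (p : nat) (p_prime : prime p) (p_neq2 : p <> 2%N)
  (gT : finGroupType) (Q F G : {group gT})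
  (cFG : G \in [complements to F in Q])
  (L : fieldExtType rat) (L_split : splitting_field cFG L)
  (P : L -> Prop) (P_prime : prime_ideal P) (P_over_p : P p%:R)
  (R : idomainType) (j : {rmorphism L -> {fraction R}}) (pi : R)
  (R_completion : is_completion P j pi)
  (k : fieldType) (red : {rmorphism R -> k}) (k_residue : is_residue_map pi red)
  (R_roots : exists z : R, (#|F|`_p^')%N.-primitive_root z)
  (n d : nat)
  (chi : n.-tuple {ffun bbasis F G -> {fraction R}})
  (chi_uniq : uniq chi) (chi_irr : forall f, f \in chi <-> irr_character cFG f)
  (phi : d.-tuple {ffun breg cFG p -> {fraction R}})
  (phi_uniq : uniq phi)
  (phi_irr : forall f, f \in phi <-> irr_brauer_character cFG red f)
  (D : 'M[int]_(n, d))
  (D_decomposition : forall i u,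
     restr_breg cFG p (tnth chi i) u = \sum_(l < d) (D i l)%:~R * tnth phi l u) :
  exists e : nat, \det (D^T *m D) = (p ^ e)%:Z.
Proof.
have [z prim_z] := R_roots.
have charR := completion_char0 j.
have pk := residue_pchar p_prime P_prime P_over_p R_completion k_residue.
have mk : (#|F|`_p^')%:R != 0 :> k.
  exact: (residue_p'nat_neq0 p_prime P_prime P_over_p R_completion k_residue) (part_pnat _ _).
have redR := residue_unimodular p_prime P_prime P_over_p R_completion k_residue.
have [V V_P] : exists V : 'I_d -> stab_repr cFG k, forall l,
    mx_irreducible (tagged (tagged (V l))) /\ forall u : breg cFG p,
      tnth phi l u = tofrac (brval p red z (tagged (tagged (V l))) (val u)).
  apply: (fin_all_exists (P := fun l (W : stab_repr cFG k) =>
    mx_irreducible (tagged (tagged W)) /\ forall u : breg cFG p,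
      tnth phi l u = tofrac (brval p red z (tagged (tagged W)) (val u)))) => l.
  exact/(irr_brauer_character_brval prim_z mk)/phi_irr/mem_tnth.
pose br l u := brval p red z (tagged (tagged (V l))) u.
pose N := #|{: bbasis F G}|; pose preg := preg_basis cFG p.
(* The matrices are indexed by the whole basis and padded with zeros off the
   p-regular loops. *)
pose Phi := \matrix_(l < d, i < N) if preg (enum_val i) then br l (enum_val i) else 0.
pose Phi' := \matrix_(i < N, l < d)
  if preg (enum_val i) then br l (bdual (bact cFG) (enum_val i)) else 0.
have sum_preg (S : nmodType) (f : bbasis F G -> S) :
    \sum_(i < N) (if preg (enum_val i) then f (enum_val i) else 0) = \sum_(u | preg u) f u.
  by rewrite [RHS]big_mkcond [RHS](reindex_onto enum_val enum_rank) /= => [|u _];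
    [apply: eq_bigl => i; rewrite enum_valK eqxx | rewrite enum_rankK].
pose C := map_mx (intr : int -> R) (D^T *m D).
pose M := \matrix_(i < N, i' < N) (if preg (enum_val i) && preg (enum_val i') then
  \sum_c (bconj (bact cFG) (enum_val i) c == enum_val i')%:R else 0) : 'M[R]_N.
have chiE s u : preg u ->
    tnth chi s u = \sum_l (D s l)%:~R * tofrac (br l u).
  move=> pu; have := D_decomposition s (exist _ u pu); rewrite ffunE /= => ->.
  by apply: eq_bigr => l _; rewrite (proj2 (V_P l)).
(* Column orthogonality, with every irreducible character expanded in Brauer
   characters. *)
have orth : Phi' *m C *m Phi = M.
  pose DK := map_mx (intr : int -> {fraction R}) D.
  have def_X : map_mx (@tofrac R) (Phi' *m C *m Phi) =
      (map_mx (@tofrac R) Phi' *m DK^T) *m (DK *m map_mx (@tofrac R) Phi).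
    have def_C : map_mx (@tofrac R) C = DK^T *m DK.
      rewrite /C /DK map_trmx -map_mxM -map_mx_comp; apply: eq_map_mx => x /=.
      by rewrite rmorph_int.
    by rewrite (map_mxM _ (Phi' *m C)) (map_mxM _ Phi') def_C !mulmxA.
  apply/matrixP => i i'; apply/eqP; rewrite -tofrac_eq; apply/eqP.
  have /matrixP/(_ i i') := def_X; rewrite mxE => ->; rewrite !mxE.
  have [pi_reg|nreg] := boolP (preg (enum_val i)); last first.
    rewrite rmorph0 big1 // => s _; rewrite mxE big1 ?mul0r // => l _.
    by rewrite !mxE (negPf nreg) rmorph0 mul0r.
  have [pi'_reg|nreg] := boolP (preg (enum_val i')); last first.
    rewrite rmorph0 big1 // => s _; rewrite [X in _ * X]mxE big1 ?mulr0 // => l _.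
    by rewrite !mxE (negPf nreg) rmorph0 mulr0.
  rewrite /= rmorph_sum /=.
  have irrP g : g \in chi <-> hirr_char (bact cFG) g.
    exact: iff_trans (chi_irr g) (irr_characterE cFG g).
  have := hirr_char_column_orth_map j (@number_field_char0 L)
    (splitting_field_hsplit L_split) (enum_val i') chi_uniq irrP (preg_loop pi_reg).
  rewrite big_tuple => e.
  have -> : \sum_c tofrac (bconj (bact cFG) (enum_val i) c == enum_val i')%:R
      = \sum_c (bconj (bact cFG) (enum_val i) c == enum_val i')%:R :> {fraction R}.
    by apply: eq_bigr => c _; rewrite rmorph_nat.
  rewrite -e; apply: eq_bigr => s _; rewrite !mxE.
  rewrite (chiE s _ (preg_basis_dual pi_reg)) (chiE s _ pi'_reg); congr (_ * _).
    by apply: eq_bigr => l _; rewrite !mxE pi_reg mulrC.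
  by apply: eq_bigr => l _; rewrite !mxE pi'_reg.
have PhiM : Phi *m M = #|F|%:R *: Phi.
  apply/matrixP => l i; rewrite !mxE.
  have [pi_reg|nreg] := boolP (preg (enum_val i)); last first.
    by rewrite mulr0 big1 // => s _; rewrite !mxE (negPf nreg) andbF mulr0.
  rewrite -(brval_conj_sum red z (tagged (tagged (V l))) pi_reg) -sum_preg.
  apply: eq_bigr => s _; rewrite !mxE pi_reg andbT.
  by case: ifP => _; rewrite ?mul0r.
have Phi_free (v : 'rV_d) : v *m Phi = 0 -> v = 0.
  move=> vPhi; apply/rowP => l; rewrite mxE; move: l.
  apply: (brval_free prim_z mk pk (rW := fun l => tagged (tagged (V l))) charR redR).
  - by move=> l; have [] := V_P l.
  - move=> l1 l2 e; apply: (tuple_uniqP _ phi_uniq); apply/ffunP => u.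
    by rewrite !(proj2 (V_P _)) e // (valP u).
  move=> u pu; have /rowP/(_ (enum_rank u)) := vPhi; rewrite !mxE => e.
  by apply: etrans e; apply: eq_bigr => l _; rewrite !mxE enum_rankK [preg u]pu.
have PhiC : Phi *m Phi' *m C = #|F|%:R%:M.
  apply/eqP; rewrite -subr_eq0; apply/eqP/row_matrixP => l; rewrite row0.
  apply: Phi_free; rewrite -row_mul mulmxBl -!mulmxA.
  by rewrite (mulmxA Phi') orth PhiM mul_scalar_mx subrr row0.
apply: (det_prime_power charR p_prime (cardG_gt0 F) (det_gram_ge0 D) PhiC).
move=> q l l' q_pr nqp; rewrite mxE.
have := int_dvd_brval_product red prim_z mk p_prime (tagged (tagged (V l)))
  (tagged (tagged (V l'))) q_pr.
rewrite eq_sym => /(_ nqp); rewrite -sum_preg.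
congr int_dvd; apply: eq_bigr => i _; rewrite !mxE.
by case: ifP => _; rewrite ?mul0r.
Qed.
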